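(* Let $d \geq 1$ be an integer, let $\vec{\alpha} = (\alpha_1,\ldots,\alpha_d) \in \mathbb{R}^d$ be a vector whose components $\alpha_1,\ldots,\alpha_d$ are linearly independent over $\mathbb{Q}$ and are all badly approximable numbers, and let $(\vec{X}_i)_{i \in \mathbb{N}}$ be a sequence of independent, identically distributed random vectors which are uniformly distributed on $[0,1]^d$. Let $\varepsilon > 0$ be arbitrary. Then the sequence of random vectors $(\vec{Y}_n)_{n \in \mathbb{N}} := \left(\left\{n \vec{\alpha} + \varepsilon \vec{X}_n\right\}\right)_{n \in \mathbb{N}}$ generically (that is, almost surely) has Poissonian pair correlations.
   Context: $\mathbb{N} = \{1,2,3,\ldots\}$. A number $\alpha \in \mathbb{R}$ is called badly approximable if there exists $c = c_\alpha > 0$ such that for all $p \in \mathbb{Z}$ and $q \in \mathbb{Z} \setminus \{0\}$ one has $\left|\alpha - \frac{p}{q}\right| > \frac{c}{q^2}$. $\{\cdot\}$ denotes the fractional part of a real number, and is applied component-wise to vectors. For $x \in \mathbb{R}$, $\|x\|$ denotes the distance of $x$ to its nearest integer, and for $x = (x_1,\ldots,x_d) \in \mathbb{R}^d$ one sets $\|x\|_\infty := \max(\|x_1\|,\ldots,\|x_d\|)$. For a sequence $(x_n)_{n\in\mathbb{N}}$ in $[0,1)^d$, $N \in \mathbb{N}$ and $s > 0$, the pair correlation function is $$F_{N,d}(s) := \frac{1}{N} \# \left\{ (k,l) : 1 \leq k \neq l \leq N, \ \left\| x_k - x_l\right\|_{\infty} \leq \frac{s}{N^{1/d}} \right\}.$$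 The sequence is said to have Poissonian pair correlations if $\lim_{N \to \infty} F_{N,d}(s) = (2s)^d$ for all $s > 0$. ''Generically'' means with probability one with respect to the random vectors $(\vec{X}_i)_{i\in\mathbb{N}}$.
   Formalization: Linear independence over Q is required of 1, α₁, …, α_d rather than of α₁, …, α_d alone; without the 1 the claim fails for d ≥ 2, e.g. α = (√2, 1+√2) with ε = 1/2, where the limit would be (4/3)(2s)². *)

(* Defs.v *)
From HB Require Import structures.
From mathcomp Require Import all_boot all_order all_algebra finmap.
From mathcomp Require Import all_classical all_reals all_analysis.

Set Implicit Arguments.
Unset Strict Implicit.
Unset Printing Implicit Defensive.

Import Order.TTheory GRing.Theory Num.Theory.
Import numFieldNormedType.Exports.

Local Open Scope classical_set_scope.
Local Open Scope ring_scope.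

(* Vectors of R^d are d.-tuple R, since this type carries the product
   (Borel) sigma-algebra.  Sequences indexed by {1, 2, 3, ...} are functions on
   nat whose value at 0 is never used. *)

Definition badly_approximable (R : realType) (a : R) : Prop :=
  exists2 c : R, 0 < c &
    forall p q : int, q != 0 ->
      c / (q%:~R ^+ 2) < `|a - p%:~R / q%:~R|.

(* Linear independence over Q of the coordinates of a rotation vector of the
   torus is meant modulo 1, as in Kronecker's theorem: it is to be applied to
   1, a_1, ..., a_d.  Dropping the 1 would give a condition that changes when
   integers are added to the a_i, and the coordinates of n (sqrt 2, 1 + sqrt 2)
   modulo 1 always coincide. *)
Definition rationally_independent (R : realType) (d : nat) (a : d.-tuple R)
    : Prop :=
  forall c : 'I_d -> rat,
    \sum_(i < d) ratr (c i) * tnth a i = 0 -> forall i, c i = 0.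

Definition frac (R : realType) (x : R) : R := x - (Num.floor x)%:~R.

Definition vfrac (R : realType) (d : nat) (x : d.-tuple R) : d.-tuple R :=
  [tuple frac (tnth x i) | i < d].

Definition dist_int (R : realType) (x : R) : R :=
  inf [set `|x - m%:~R| | m in [set: int]].

(* dist_int is nonnegative, so the default value 0 does not affect the
   maximum. *)
Definition dist_int_max (R : realType) (d : nat) (x : d.-tuple R) : R :=
  \big[Num.max/0]_(i < d) dist_int (tnth x i).

Definition vsub (R : realType) (d : nat) (x y : d.-tuple R) : d.-tuple R :=
  [tuple tnth x i - tnth y i | i < d].

Definition pair_correlation (R : realType) (d : nat) (x : nat -> d.-tuple R)
    (N : nat) (s : R) : R :=
  N%:R^-1 *
  #|[pred kl : 'I_N.+1 * 'I_N.+1 |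
      [&& (1 <= kl.1)%N, (1 <= kl.2)%N, kl.1 != kl.2 &
        dist_int_max (vsub (x kl.1) (x kl.2))
          <= s / (N%:R `^ (d%:R^-1))]]|%:R.

Definition poissonian_pair_correlations (R : realType) (d : nat)
    (x : nat -> d.-tuple R) : Prop :=
  forall s : R, 0 < s ->
    pair_correlation x N s @[N --> \oo] --> (2 * s) ^+ d.

Section lebesgue_tuple.
Context {R : realType}.

(* lebesgue_measure is declared on measurableTypeR R, which has the same
   sigma-algebra as R but another display. *)
Definition cons_pair (n : nat) (p : measurableTypeR R * n.-tuple R)
    : n.+1.-tuple R :=
  [tuple of (p.1 : R) :: p.2].

Lemma measurable_cons_pair (n : nat) :
  measurable_fun [set: measurableTypeR R * n.-tuple R] (@cons_pair n).
Proof.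
apply: (@measurable_cons _ _ _ _ (fun p : measurableTypeR R * n.-tuple R =>
  p.1 : R) _ (fun p => p.2)); last exact: measurable_snd.
exact: (@measurable_fst _ _ (measurableTypeR R) (n.-tuple R)).
Qed.

Section step.
Variables (n : nat) (m : {sigma_finite_measure set (n.-tuple R) -> \bar R}).

Definition lebesgue_cons : set (n.+1.-tuple R) -> \bar R :=
  pushforward (@lebesgue_measure R \x m)%E (@cons_pair n).

Let preimage_cons_pair_measurable (A : set (n.+1.-tuple R)) :
  measurable A -> measurable (@cons_pair n @^-1` A).
Proof.
by move=> mA; rewrite -[X in measurable X]setTI; exact: measurable_cons_pair.
Qed.

Let lebesgue_cons0 : lebesgue_cons set0 = 0%E.
Proof. by rewrite /lebesgue_cons /pushforward preimage_set0 measure0. Qed.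

Let lebesgue_cons_ge0 A : (0 <= lebesgue_cons A)%E.
Proof. by rewrite /lebesgue_cons /pushforward measure_ge0. Qed.

Let lebesgue_cons_sigma_additive : semi_sigma_additive lebesgue_cons.
Proof.
move=> F mF tF mUF; rewrite /lebesgue_cons /pushforward preimage_bigcup.
apply: measure_semi_sigma_additive.
- by move=> k; exact: preimage_cons_pair_measurable.
- apply/trivIsetP => /= i j _ _ ij; rewrite -preimage_setI.
  by move/trivIsetP : tF => /(_ _ _ _ _ ij) ->//; rewrite preimage_set0.
- by rewrite -preimage_bigcup; exact: preimage_cons_pair_measurable.
Qed.

HB.instance Definition _ := isMeasure.Build _ _ _ lebesgue_cons
  lebesgue_cons0 lebesgue_cons_ge0 lebesgue_cons_sigma_additive.

Let lebesgue_cons_sigma_finite : sigma_finite [set: _] lebesgue_cons.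
Proof.
have /sigma_finiteP[F [FT ndF Foo]] := sigma_finiteT (@lebesgue_measure R).
have /sigma_finiteP[G [GT ndG Goo]] := sigma_finiteT m.
pose g (t : n.+1.-tuple R) : measurableTypeR R * n.-tuple R :=
  (tnth t ord0, [tuple of behead t]).
have mg : measurable_fun [set: _] g.
  apply/measurable_fun_pair => /=; last exact: measurable_behead.
  exact: (@measurable_tnth _ R).
have gK p : g (cons_pair p) = p.
  by case: p => x t; congr pair; exact/val_inj.
exists (fun k => g @^-1` (F k `*` G k)).
  rewrite -preimage_bigcup (_ : \bigcup_k _ = setT) ?preimage_setT//.
  apply/seteqP; split=> // -[x y] _.
  have [i _ Fx] : (\bigcup_k F k) x by rewrite -FT.
  have [j _ Gy] : (\bigcup_k G k) y by rewrite -GT.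
  exists (maxn i j) => //; split => /=.
  - by move: x Fx; exact/subsetPset/ndF/leq_maxl.
  - by move: y Gy; exact/subsetPset/ndG/leq_maxr.
move=> k; have [mF Fk] := Foo k; have [mG Gk] := Goo k; split.
  by rewrite -[X in measurable X]setTI; apply: mg => //; exact: measurableX.
rewrite /lebesgue_cons /pushforward (_ : _ @^-1` _ = F k `*` G k); last first.
  by apply/funext => p; rewrite -[in RHS](gK p).
by rewrite product_measure1E// lte_mul_pinfty// ge0_fin_numE.
Qed.

HB.instance Definition _ := Measure_isSigmaFinite.Build _ _ _ lebesgue_cons
  lebesgue_cons_sigma_finite.

End step.

(* The d-dimensional Lebesgue measure: the d-fold product of the Lebesgue
   measure on R, starting from the unit mass on the one-point space R^0. *)
Fixpoint lebesgue_tuple (d : nat)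
    : {sigma_finite_measure set (d.-tuple R) -> \bar R} :=
  if d is n.+1 then lebesgue_cons (lebesgue_tuple n)
  else \d_([tuple] : 0.-tuple R).

End lebesgue_tuple.

Definition unit_cube (R : realType) (d : nat) : set (d.-tuple R) :=
  [set x | forall i, 0 <= tnth x i <= 1].

Definition uniform_on_cube (disp : measure_display)
    (Omega : measurableType disp) (R : realType) (P : probability Omega R)
    (d : nat) (X : {RV P >-> d.-tuple R}) : Prop :=
  forall A : set (d.-tuple R), measurable A ->
    distribution P X A = lebesgue_tuple d (A `&` @unit_cube R d).

Definition mutually_independent (disp disp' : measure_display)
    (Omega : measurableType disp) (T : measurableType disp') (R : realType)
    (P : probability Omega R) (I : choiceType) (D : set I)
    (X : I -> {RV P >-> T}) : Prop :=
  forall (J : {fset I}) (A : I -> set T),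
    [set` J] `<=` D -> (forall i, i \in J -> measurable (A i)) ->
    P (\bigcap_(i in [set` J]) X i @^-1` A i) =
      (\prod_(i <- J) P (X i @^-1` A i))%E.

(* Main.v *)
Require Import Defs.
From mathcomp Require Import all_boot all_order all_algebra finmap.
From mathcomp Require Import all_classical all_reals all_analysis.
From mathcomp Require Import measurable_realfun.
From mathcomp Require Import ring lra zify.
Import Order.TTheory GRing.Theory Num.Theory.
Import numFieldNormedType.Exports.
Set Implicit Arguments.
Unset Strict Implicit.
Unset Printing Implicit Defensive.
Local Open Scope classical_set_scope.
Local Open Scope ring_scope.

(** Modulo 1, [eps (X_k - X_l)] has in each coordinate the density
    [g = 1 + Delta^2 chi / (2 eps^2)], where [chi t = {t} (1 - {t})] and
    [Delta^2] is the second difference of step [eps].  Up to an error of smaller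
    order, a pair [(k, l)] is thus counted with probability
    [(2 s)^d / N * prod_i g ((k - l) alpha_i)].  As [chi] is a uniform limit of
    cosine sums and [1, alpha_1, ..., alpha_d] are independent over the
    rationals, Weyl's argument shows that the average of these products over
    [k, l <= N] tends to 1, so that the expectation of the pair correlation
    function tends to [(2 s)^d].  Events attached to disjoint pairs are
    independent, and two events sharing one index have a joint probability
    [O (N^-2)]; hence the variance is [O (1 / N)].  Chebyshev's inequality and
    the Borel-Cantelli lemma give almost sure convergence along [N = m^2], for
    all rational [s]; monotonicity of the number of close pairs in [N] and in the
    distance fills the gaps between consecutive squares. *)

(* [fraction.frac] shadows the fractional part. *)
Local Notation frac := Defs.frac.

(** * Uniform approximation by cosine sums *)

(** The rescaled probability of one pair depends on [k - l] and is close to [(2 s)^d] only on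
    average over pairs. The form of the density comes from the triangle: [U - V] has density
    [max (0, 1 - |b|)], which is half a second difference of [|b|], and the sum of [|u - j|] over
    [j = 0, ..., L] is a quadratic polynomial in [u] plus [chi u]. Summing the scaled triangle over
    integer translates thus gives the second difference of a quadratic, which accounts for the
    constant 1, and that of [chi]. The one-coordinate estimates have to be uniform in the phase
    [(k - l) alpha_i], which is unbounded, and for two events with a common index also in the common
    vector. An error bound per translate would be multiplied by the number of translates; instead
    each error is dominated by a wider triangle, whose sum over translates is bounded by the same
    formula. About [N^3] couples of pairs share an index, so a joint probability [O (N^-2)] is
    exactly what makes the normalised variance [O (1 / N)]. This is not summable over [N] but is
    summable over squares. *)

Section bernstein.
Context {R : realType}.
Implicit Types (f g : nat -> R) (x : R).

(* The expectation of [f B] for a binomial variable [B] of parameters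
   [n] and [x]: the recursion replaces binomial coefficients. *)
Fixpoint bernstein n f x : R :=
  if n is m.+1 then
    x * bernstein m (fun j => f j.+1) x + (1 - x) * bernstein m f x
  else f 0%N.

Lemma bernstein_affine n f a b x :
  bernstein n (fun j => a + b * f j) x = a + b * bernstein n f x.
Proof. by elim: n f => [//|n IH] f /=; rewrite !IH; ring. Qed.

Lemma le_bernstein n f g x : 0 <= x <= 1 ->
  (forall j, (j <= n)%N -> f j <= g j) -> bernstein n f x <= bernstein n g x.
Proof.
move=> /andP[x0 x1]; elim: n f g => [|n IH] f g fg /=; first exact: fg.
apply: lerD; apply: ler_wpM2l; rewrite ?subr_ge0//; apply: IH => j jn.
  exact: fg.
exact/fg/leqW.
Qed.

(** The free centre [a] makes the induction work, since a shift of the argument is absorbed in it.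
    At [a = n x] this is the variance of the binomial law. *)
Lemma bernstein_sqr n a x :
  bernstein n (fun j => (j%:R - a) ^+ 2) x =
  (n%:R * x - a) ^+ 2 + n%:R * x * (1 - x).
Proof.
elim: n a => [|n IH] a /=; first by ring.
have -> : (fun j : nat => (j.+1%:R - a) ^+ 2) = (fun j => (j%:R - (a - 1)) ^+ 2).
  by apply/funext => j; rewrite -natr1; congr (_ ^+ 2); ring.
by rewrite !IH -natr1; ring.
Qed.

(** Bernstein's proof of the Weierstrass theorem: taking expectations turns the quadratic error into
    [C] times the variance [x (1 - x) / n]. *)
Lemma bernstein_approx n f x y eta C : (0 < n)%N -> 0 <= x <= 1 -> 0 <= C ->
  (forall j, (j <= n)%N -> `|y - f j| <= eta + C * (j%:R / n%:R - x) ^+ 2) ->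
  `|y - bernstein n f x| <= eta + C / n%:R.
Proof.
move=> n0 x01 C0 fE; have n0' : 0 < n%:R :> R by rewrite ltr0n.
pose h j := (j%:R - n%:R * x) ^+ 2 : R.
have hE j : C * (j%:R / n%:R - x) ^+ 2 = C / n%:R ^+ 2 * h j.
  by rewrite /h; field; rewrite gt_eqF.
have bh : bernstein n h x <= n%:R.
  rewrite bernstein_sqr subrr expr0n add0r -mulrA ler_piMr ?ler0n//.
  by move: x01 => /andP[x0 x1]; rewrite mulr_ile1// ?subr_ge0// lerBlDr lerDl.
have bhC : C / n%:R ^+ 2 * bernstein n h x <= C / n%:R.
  apply: (@le_trans _ _ (C / n%:R ^+ 2 * n%:R)).
    by rewrite ler_wpM2l// divr_ge0// exprn_ge0// ltW.
  by rewrite le_eqVlt; apply/orP; left; apply/eqP; field; rewrite gt_eqF.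
rewrite ler_distlC; apply/andP; split.
- rewrite (@le_trans _ _ (y - eta + - (C / n%:R ^+ 2) * bernstein n h x))//.
    lra.
  rewrite -bernstein_affine; apply: le_bernstein => // j jn.
  have := fE _ jn; rewrite hE ler_norml => /andP[_]; lra.
- rewrite (@le_trans _ _ (y + eta + C / n%:R ^+ 2 * bernstein n h x))//; last lra.
  rewrite -bernstein_affine; apply: le_bernstein => // j jn.
  have := fE _ jn; rewrite hE ler_norml => /andP[]; lra.
Qed.

End bernstein.

Section cosine_sums.
Context {R : realType}.
Implicit Types (t : R).

Definition tau : R := pi *+ 2.

Lemma cosDtau_int x (m : int) : cos (x + tau * m%:~R) = cos x :> R.
Proof.
have H n y : cos (y + tau * n%:R) = cos y.
  by rewrite mulr_natr periodicn//; exact: cosD2pi.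
case: m => n; first exact: H.
by rewrite NegzE mulrNz mulrN -{2}(subrK (tau * n.+1%:R) x) H.
Qed.

(** Coefficients paired with frequencies. Frequencies may repeat, so that addition is concatenation
    and no normal form has to be maintained. *)
Definition cos_sum (s : seq (R * nat)) t : R :=
  \sum_(p <- s) p.1 * cos (tau * (p.2%:R * t)).

Lemma cos_sum_cat s1 s2 t : cos_sum (s1 ++ s2) t = cos_sum s1 t + cos_sum s2 t.
Proof. exact: big_cat. Qed.

Lemma cos_sumZ a s :
  exists s', forall t, cos_sum s' t = a * cos_sum s t.
Proof.
exists [seq (a * p.1, p.2) | p <- s] => t.
rewrite /cos_sum big_map mulr_sumr; apply: eq_bigr => p _ /=; ring.
Qed.

Lemma cosMcos (a b : R) : cos a * cos b = (cos (a + b) + cos (a - b)) / 2.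
Proof. by rewrite cosD cosB; field. Qed.

Lemma cos_sumM s : exists s', forall t, cos_sum s' t = cos_sum s t * cos (tau * t).
Proof.
elim: s => [|[a n] s [s' sE]].
  by exists [::] => t; rewrite /cos_sum !big_nil mul0r.
(* The frequencies of the product are [n + 1] and [|n - 1|]; the latter is 1 for [n = 0], as cosine
   is even. *)
exists ([:: (a / 2, n.+1); (a / 2, if n is m.+1 then m else 1%N)] ++ s') => t.
rewrite cos_sum_cat sE /cos_sum !big_cons big_nil /= addr0 [in RHS]mulrDl -[a * cos _ * _ in RHS]mulrA [in RHS]cosMcos.
rewrite (_ : tau * (n%:R * t) + tau * t = tau * (n.+1%:R * t)); last first.
  by rewrite -natr1; ring.
have -> : cos (tau * (n%:R * t) - tau * t) =
          cos (tau * ((if n is m.+1 then m else 1)%N%:R * t)).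
  case: n => [|n]; first by rewrite mul0r mulr0 mul1r sub0r cosN.
  by rewrite -natr1; congr cos; ring.
by congr (_ + _); field.
Qed.

(** With [x = (1 - cos) / 2], the recursion of [bernstein] only multiplies by [(1 - cos) / 2] and
    [(1 + cos) / 2], which preserves cosine sums. *)
Lemma cos_sum_bernstein n f :
  exists s, forall t, cos_sum s t = bernstein n f ((1 - cos (tau * t)) / 2).
Proof.
elim: n f => [|n IH] f.
  exists [:: (f 0%N, 0%N)] => t.
  by rewrite /cos_sum big_seq1 /= mul0r mulr0 cos0 mulr1.
have [s1 E1] := IH (fun j => f j.+1); have [s2 E2] := IH f.
have [s1h E1h] := cos_sumZ 2^-1 s1; have [s2h E2h] := cos_sumZ 2^-1 s2.
have [s1m E1m] := cos_sumM s1h; have [s2m E2m] := cos_sumM s2h.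
have [s3 E3] := cos_sumZ (-1) s1m.
exists (s1h ++ s2h ++ s2m ++ s3) => t.
rewrite !cos_sum_cat E3 E1m E2m E1h E2h E1 E2 /=.
by field.
Qed.

(* Up to an affine change this is the periodic Bernoulli polynomial [B_2]. *)
Definition chi t : R := frac t * (1 - frac t).

Lemma frac_itv t : 0 <= frac t < 1.
Proof.
by have /andP[] := floor_itv t; rewrite intrD/= /frac; lra.
Qed.

Lemma chi_ge0 t : 0 <= chi t.
Proof. by have /andP[? ?] := frac_itv t; rewrite /chi mulr_ge0//; lra. Qed.

Lemma chi_le1 t : chi t <= 1.
Proof.
have /andP[? ?] := frac_itv t; rewrite /chi mulr_ile1//; lra.
Qed.

Lemma sin_sqrE (x : R) : sin x ^+ 2 = (1 - cos (x *+ 2)) / 2.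
Proof. by rewrite cos_mulr2n cos2sin2 mulr2n; field. Qed.

(** The representative of [t] in [[0, 1/2]] modulo integers and sign. Both [chi] and [cos (tau * t)]
    factor through it, and [sin^2 (pi t)] is injective on that interval. *)
Let fold t := Num.min (frac t) (1 - frac t).

Let fold_itv t : 0 <= fold t <= 2^-1.
Proof.
rewrite /fold; have /andP[? ?] := frac_itv t.
by case: (leP (frac t) (1 - frac t)) => ?; lra.
Qed.

Let chi_fold t : chi t = fold t * (1 - fold t).
Proof.
by rewrite /fold /chi; case: (leP (frac t) (1 - frac t)) => ?; ring.
Qed.

Let cos_fold t : cos (tau * t) = cos (tau * fold t).
Proof.
have -> : cos (tau * t) = cos (tau * frac t).
  by rewrite -[RHS](cosDtau_int _ (Num.floor t)) /frac; congr cos; ring.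
rewrite /fold; case: (leP (frac t) (1 - frac t)) => // ?.
by rewrite -[LHS]cosN -[LHS](cosDtau_int _ 1); congr cos; ring.
Qed.

(** Quantitative injectivity of [sin^2 (pi t)] on [[0, 1/2]]: the difference factors as
    [sin (pi (a - b)) sin (pi (a + b))], and both [a - b] and [a + b] lie in [[eta, 1 - eta]]. *)
Let sin_sep (eta a b : R) : 0 < eta < 2^-1 -> 0 <= a <= 2^-1 -> 0 <= b <= 2^-1 ->
  eta <= a - b -> sin (pi * eta) ^+ 2 <= sin (pi * a) ^+ 2 - sin (pi * b) ^+ 2.
Proof.
move=> eta0 a0 b0 ab.
have -> : sin (pi * a) ^+ 2 - sin (pi * b) ^+ 2 =
          sin (pi * (a - b)) * sin (pi * (a + b)).
  rewrite mulrBr mulrDr sinB sinD.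
  by rewrite -subr_sqr !exprMn !cos2sin2; ring.
have p0 := @pi_gt0 R.
have s_ge (c : R) : eta <= c <= 2^-1 -> sin (pi * eta) <= sin (pi * c).
  move=> /andP[]; rewrite le_eqVlt => /predU1P[->//|ec c2].
  by apply/ltW; rewrite ltr_sin ?in_itv/= ?ltr_pM2l//; nra.
have s_ge' (c : R) : eta <= c -> eta <= 1 - c -> sin (pi * eta) <= sin (pi * c).
  move=> c0 c1; have [c2|c2] := leP c (2^-1); first by rewrite s_ge; lra.
  have -> : sin (pi * c) = sin (pi * (1 - c)).
    by rewrite mulrBr mulr1 sinB sinpi cospi; ring.
  rewrite s_ge; lra.
have s0 : 0 <= sin (pi * eta) by apply: sin_ge0_pi; nra.
rewrite expr2; apply: ler_pM => //; apply: s_ge'; lra.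
Qed.

(** [chi t] is a continuous function of [x = sin^2 (pi t)], hence close to a Bernstein polynomial in
    [x], which is a cosine sum in [t]. *)
Lemma chi_approx (eta : R) : 0 < eta ->
  exists s, forall t, `|chi t - cos_sum s t| <= eta.
Proof.
move=> eta0.
pose e := Num.min (eta / 2) 4^-1.
have e_itv : 0 < e <= 4^-1.
  by rewrite /e; case: (leP (eta / 2) 4^-1) => ?; lra.
have e_eta : e <= eta / 2 by rewrite /e ge_min lexx.
have p0 := @pi_gt0 R.
have se0 : 0 < sin (pi * e) by apply: sin_gt0_pi; nra.
pose C := (sin (pi * e) ^+ 4)^-1.
have C0 : 0 < C by rewrite invr_gt0 exprn_gt0.
pose n := (Num.truncn (2 * C / eta)).+1.
have nC : C / n%:R <= eta / 2.
  have : 2 * C / eta < n%:R by exact: truncnS_gt.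
  have n0 : 0 < n%:R :> R by rewrite ltr0n.
  rewrite ltr_pdivrMr// ler_pdivrMr// => ?; lra.
(* The point of [[0, 1/2]] at which [sin^2 (pi t)] takes the value [j / n]. *)
pose node j := asin (Num.sqrt (j%:R / n%:R)) / pi : R.
have n0 : 0 < n%:R :> R by rewrite ltr0n.
have sq01 j : (j <= n)%N -> 0 <= Num.sqrt (j%:R / n%:R : R) <= 1.
  move=> jn; rewrite sqrtr_ge0/= -[leRHS]sqrtr1 ler_sqrt// ler_pdivrMr// mul1r.
  by rewrite ler_nat.
have sin_node j : (j <= n)%N -> sin (pi * node j) ^+ 2 = j%:R / n%:R.
  move=> jn; rewrite /node mulrCA divff ?gt_eqF// mulr1 asinK; last first.
    by have := sq01 _ jn; rewrite in_itv/=; lra.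
  by rewrite sqr_sqrtr// divr_ge0// ler0n.
have node_itv j : (j <= n)%N -> 0 <= node j <= 2^-1.
  move=> jn; have := sq01 _ jn => /andP[s0 s1].
  have a1 : asin (Num.sqrt (j%:R / n%:R)) <= (pi : R) / 2 by rewrite asin_lepi2//; lra.
  have a2 : - ((pi : R) / 2) <= asin (Num.sqrt (j%:R / n%:R)) by rewrite asin_geNpi2//; lra.
  have a0 : 0 <= asin (Num.sqrt (j%:R / n%:R)) :> R.
    rewrite leNgt; apply/negP => alt0.
    have : sin (asin (Num.sqrt (j%:R / n%:R))) < sin 0 :> R.
      rewrite ltr_sin ?in_itv//=; lra.
    rewrite asinK ?in_itv/= ?sin0; lra.
  rewrite /node divr_ge0 ?(ltW p0)//= ler_pdivrMr//; lra.
have [s sE] := cos_sum_bernstein n (fun j => chi (node j)).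
exists s => t; rewrite sE.
have xE : (1 - cos (tau * t)) / 2 = sin (pi * fold t) ^+ 2.
  by rewrite sin_sqrE cos_fold mulrnAl.
rewrite (@le_trans _ _ (e + C / n%:R))//; last lra.
apply: bernstein_approx => //; [|exact: ltW|].
  have := cos_le1 (tau * t); have := cos_geN1 (tau * t); lra.
move=> j jn; rewrite xE -sin_node//.
have nodej := node_itv _ jn; have ft := fold_itv t.
have -> : chi (node j) = node j * (1 - node j).
  rewrite /chi /frac (@floor_def _ _ 0) ?subr0//.
  by move: nodej; rewrite add0r /=; lra.
rewrite chi_fold; move: (node j) (fold t) nodej ft => b a bh ah.
have sq0 (z : R) : 0 <= C * z ^+ 2 by rewrite mulr_ge0 ?sqr_ge0// ltW.
(* For close points, [t (1 - t)] is 1-Lipschitz on [[0, 1/2]]. For distant ones the error is at most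
   1, and [sin_sep] makes the quadratic term at least 1 by the choice of [C]. *)
have [ab|ab] := leP `|a - b| e.
  rewrite ler_wpDr//; apply: le_trans ab.
  have -> : a * (1 - a) - b * (1 - b) = (a - b) * (1 - a - b) by ring.
  by rewrite normrM ler_piMr// ler_norml; lra.
rewrite (@le_trans _ _ 1)//; first by rewrite ler_norml; nra.
rewrite ler_wpDl//; first lra.
rewrite /C mulrC ler_pdivlMr ?exprn_gt0// mul1r (exprM _ 2 2).
have e_lt : 0 < e < 2^-1 by lra.
have sin_sep' : sin (pi * e) ^+ 2 <= `|sin (pi * a) ^+ 2 - sin (pi * b) ^+ 2|.
  have [ba|ba] := leP b a.
  - apply: le_trans (ler_norm _); apply: sin_sep => //.
    by rewrite ger0_norm ?subr_ge0// in ab; exact: ltW.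
  - rewrite distrC; apply: le_trans (ler_norm _); apply: sin_sep => //.
    by rewrite ltr0_norm ?subr_lt0// opprB in ab; exact: ltW.
rewrite -[leRHS]real_normK ?num_real// distrC ler_sqr ?nnegrE//.
exact: sqr_ge0.
Qed.

End cosine_sums.

(** * Equidistribution *)

Section difference_average.
Context {R : realType}.
Implicit Types (F G : R -> R) (N : nat).

(** Only differences enter, so the indices may run from 0 to [N - 1] in place of 1 to [N]. *)
Definition diff_avg F N : R :=
  (N%:R ^+ 2)^-1 * \sum_(k < N) \sum_(l < N) F (k%:R - l%:R).

Lemma diff_avgD F G N : diff_avg (fun z => F z + G z) N = diff_avg F N + diff_avg G N.
Proof.
rewrite /diff_avg -mulrDr -big_split; congr (_ * _).
by apply: eq_bigr => k _; rewrite big_split.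
Qed.

Lemma diff_avgZ a F N : diff_avg (fun z => a * F z) N = a * diff_avg F N.
Proof.
rewrite /diff_avg mulrCA; congr (_ * _); rewrite mulr_sumr.
by apply: eq_bigr => k _; rewrite mulr_sumr.
Qed.

Lemma diff_avg_sum (I : finType) (F : I -> R -> R) N :
  diff_avg (fun z => \sum_i F i z) N = \sum_i diff_avg (F i) N.
Proof.
rewrite /diff_avg -mulr_sumr [in RHS]exchange_big; congr (_ * _).
by apply: eq_bigr => k _; exact: exchange_big.
Qed.

Lemma diff_avg_cst a N : (0 < N)%N -> diff_avg (fun=> a) N = a.
Proof.
move=> N0; rewrite /diff_avg.
under eq_bigr do rewrite sumr_const card_ord.
rewrite sumr_const card_ord.
have N0' : N%:R != 0 :> R by rewrite pnatr_eq0 -lt0n.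
by rewrite -(mulr_natr (a *+ N)) -(mulr_natr a); field.
Qed.

Lemma diff_avg_dist F G eta N : 0 <= eta -> (forall z, `|F z - G z| <= eta) ->
  `|diff_avg F N - diff_avg G N| <= eta.
Proof.
move=> eta0 FG; case: N => [|N].
  by rewrite /diff_avg !big_ord0 !mulr0 subrr normr0.
have -> : diff_avg F N.+1 - diff_avg G N.+1 = diff_avg (fun z => F z - G z) N.+1.
  rewrite diff_avgD; congr (_ + _).
  under [in RHS]eq_fun do rewrite -mulN1r.
  by rewrite diff_avgZ mulN1r.
rewrite -[leRHS](@diff_avg_cst eta N.+1)// /diff_avg normrM ger0_norm ?invr_ge0 ?sqr_ge0//.
rewrite ler_wpM2l ?invr_ge0 ?sqr_ge0//.
by do 2! (apply: le_trans (ler_norm_sum _ _ _) _; apply: ler_sum => ? _).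
Qed.

(** Multiplication by [2 sin h] makes the sum telescope; so the sum stays bounded in [N] when
    [sin h] is nonzero. The sum of sines below is treated likewise. *)
Lemma sin_mul_sum_cos (h : R) N : 2 * sin h * \sum_(k < N) cos (h * 2 * k%:R) =
  sin (h * (2 * N%:R - 1)) + sin h.
Proof.
elim: N => [|N IH]; first by rewrite big_ord0 !mulr0 sub0r mulrN1 sinN; ring.
rewrite big_ord_recr/= mulrDr IH -[N.+1%:R]natr1.
have -> : h * (2 * (N%:R + 1) - 1) = h * 2 * N%:R + h by ring.
have -> : h * (2 * N%:R - 1) = h * 2 * N%:R - h by ring.
by rewrite sinB sinD; ring.
Qed.

Lemma sin_mul_sum_sin (h : R) N : 2 * sin h * \sum_(k < N) sin (h * 2 * k%:R) =
  cos h - cos (h * (2 * N%:R - 1)).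
Proof.
elim: N => [|N IH]; first by rewrite big_ord0 !mulr0 sub0r mulrN1 cosN; ring.
rewrite big_ord_recr/= mulrDr IH -[N.+1%:R]natr1.
have -> : h * (2 * (N%:R + 1) - 1) = h * 2 * N%:R + h by ring.
have -> : h * (2 * N%:R - 1) = h * 2 * N%:R - h by ring.
by rewrite cosB cosD; ring.
Qed.

Lemma sin_pi_neq0 (b : R) : (forall p : int, b != p%:~R) -> sin (pi * b) != 0.
Proof.
move=> bZ.
have f01 : 0 < frac b < 1.
  have /andP[f0 ->] := frac_itv b; rewrite andbT lt_neqAle f0 andbT eq_sym.
  by rewrite subr_eq0.
have p0 := @pi_gt0 R.
have sf : 0 < sin (pi * frac b) by apply: sin_gt0_pi; nra.
(* An integer shift of [b] may change the sign of [sin (pi * b)], so it is the square that is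
   reduced to the fractional part. *)
rewrite -sqrf_eq0 sin_sqrE -mulrnAl -[cos _](cosDtau_int _ (- Num.floor b)).
have -> : pi *+ 2 * b + tau * (- Num.floor b)%:~R = (pi * frac b) *+ 2.
  by rewrite /tau /frac mulrNz; ring.
by rewrite -sin_sqrE sqrf_eq0 gt_eqF.
Qed.

(** The double sum is the squared modulus of an exponential sum, that is the square of the cosine
    sum plus the square of the sine sum. Both stay bounded, so the average is [O (N^-2)]. *)
Lemma diff_avg_cos (b : R) : (forall p : int, b != p%:~R) ->
  diff_avg (fun z => cos (tau * (b * z))) N @[N --> \oo] --> (0 : R).
Proof.
move=> /sin_pi_neq0 sb; pose h := pi * b.
have hE z : tau * (b * z) = h * 2 * z by rewrite /tau /h; ring.
have sumE N : \sum_(k < N) \sum_(l < N) cos (tau * (b * (k%:R - l%:R))) =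
   (\sum_(k < N) cos (h * 2 * k%:R)) ^+ 2 + (\sum_(k < N) sin (h * 2 * k%:R)) ^+ 2.
  rewrite !expr2 !big_distrlr/= -big_split/=; apply: eq_bigr => k _.
  by rewrite -big_split/=; apply: eq_bigr => l _; rewrite hE mulrBr cosB.
pose C := 2 * (sin h ^+ 2)^-1.
have s0 : 0 < sin h ^+ 2 by rewrite lt_neqAle sqr_ge0 andbT eq_sym sqrf_eq0.
have C0 : 0 <= C by rewrite mulr_ge0// invr_ge0 ltW.
have bound (u x y : R) : 2 * sin h * u = x + y -> `|x| <= 1 -> `|y| <= 1 ->
    u ^+ 2 <= (sin h ^+ 2)^-1.
  move=> E; rewrite !ler_norml => x1 y1; rewrite -[leRHS]mulr1 ler_pdivlMl//.
  have : (2 * sin h * u) ^+ 2 <= 4 by rewrite E; nra.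
  by rewrite !exprMn; lra.
have le_avg N : `|diff_avg (fun z => cos (tau * (b * z))) N| <= C * (N%:R ^+ 2)^-1.
  rewrite /diff_avg sumE normrM ger0_norm ?invr_ge0 ?sqr_ge0// mulrC.
  rewrite ler_wpM2r ?invr_ge0 ?sqr_ge0// ger0_norm ?addr_ge0 ?sqr_ge0//.
  rewrite /C mulr2n mulrDl mul1r lerD//.
    by apply: bound (sin_mul_sum_cos h N) _ _; rewrite sin_max.
  by apply: bound (sin_mul_sum_sin h N) _ _; rewrite ?normrN cos_max.
apply/norm_cvg0P.
(* [harmonic n] is [1 / (n + 1)], so [harmonic N.-1] is [1 / N], which dominates [N^-2]. *)
apply: (@squeeze_cvgr _ _ _ _ (fun=> 0) (fun N => C * harmonic N.-1)).
- near=> N; rewrite normr_ge0/= (le_trans (le_avg N))// ler_wpM2l//.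
  have N0 : (0 < N)%N by near: N; exists 1%N.
  rewrite /harmonic/= prednK// lef_pV2 ?posrE ?exprn_gt0 ?ltr0n//.
  by rewrite -natrX ler_nat -{1}(expn1 N) leq_pexp2l.
- exact: cvg_cst.
- have h0 : harmonic N.-1 @[N --> \oo] --> (0 : R).
    by rewrite -cvg_shiftS; exact: cvg_harmonic.
  by rewrite -(mulr0 C); exact: cvgM (cvg_cst C) h0.
Unshelve. all: by end_near. Qed.

End difference_average.

(** * The density of a perturbed difference modulo 1 *)

Section dens.
Context {R : realType}.
Implicit Types (e t : R).

(* The density modulo 1 of [e (U - V)], where [U] and [V] are independent and
   uniform on [[0, 1]]. *)
Definition dens e t : R :=
  1 + (chi (t + e) - 2 * chi t + chi (t - e)) / (2 * e ^+ 2).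

Lemma dens_norm_le e t : 0 < e -> `|dens e t| <= 1 + e ^- 2.
Proof.
move=> e0; have e2 : 0 < 2 * e ^+ 2 by rewrite mulr_gt0// exprn_gt0.
apply: le_trans (ler_normD _ _) _; rewrite normr1 lerD2l normrM.
rewrite [X in _ * X]ger0_norm ?invr_ge0 ?(ltW e2)// ler_pdivrMr//.
have -> : e ^- 2 * (2 * e ^+ 2) = 2 by field; rewrite gt_eqF.
have := chi_ge0 t; have := chi_le1 t; have := chi_ge0 (t + e); have := chi_le1 (t + e).
have := chi_ge0 (t - e); have := chi_le1 (t - e); rewrite ler_norml; lra.
Qed.

(* The constant term of a cosine sum is killed by the second difference. *)
Lemma dens_approx e (eta : R) : 0 < e -> 0 < eta ->
  exists2 s : seq (R * nat), (forall p, p \in s -> p.2 = 0%N -> p.1 = 0) &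
    forall t, `|dens e t - (1 + cos_sum s t)| <= eta.
Proof.
move=> e0 eta0; have e2 : 0 < e ^+ 2 by rewrite exprn_gt0.
(* The weights 1, 2, 1 of the second difference add up to 4, and the divisor is [2 e^2]. *)
have [|s sE] := @chi_approx R (eta * e ^+ 2 / 2); first by rewrite divr_gt0 ?mulr_gt0.
(* Cosines are eigenfunctions of the second difference of step [e], with eigenvalue
   [2 (cos (tau n e) - 1)] at frequency [n]. *)
exists [seq (p.1 * (cos (tau * (p.2%:R * e)) - 1) / e ^+ 2, p.2) | p <- s].
  move=> _ /mapP[p _ ->] /= ->.
  by rewrite mul0r mulr0 cos0 subrr mulr0 mul0r.
move=> t.
have -> : cos_sum [seq (p.1 * (cos (tau * (p.2%:R * e)) - 1) / e ^+ 2, p.2) | p <- s] t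
   = (cos_sum s (t + e) - 2 * cos_sum s t + cos_sum s (t - e)) / (2 * e ^+ 2).
  rewrite /cos_sum big_map mulr_sumr -sumrB -big_split/= mulr_suml.
  apply: eq_bigr => p _ /=; set x := tau * (p.2%:R * t).
  have -> : tau * (p.2%:R * (t - e)) = x - tau * (p.2%:R * e) by rewrite /x; ring.
  have -> : tau * (p.2%:R * (t + e)) = x + tau * (p.2%:R * e) by rewrite /x; ring.
  rewrite cosB cosD.
  by field; rewrite gt_eqF.
have -> : dens e t - (1 + (cos_sum s (t + e) - 2 * cos_sum s t + cos_sum s (t - e)) / (2 * e ^+ 2))
  = ((chi (t + e) - cos_sum s (t + e)) - 2 * (chi t - cos_sum s t) +
     (chi (t - e) - cos_sum s (t - e))) / (2 * e ^+ 2).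
  by rewrite /dens; field; rewrite gt_eqF.
have e20 : 0 < 2 * e ^+ 2 by rewrite mulr_gt0.
rewrite normrM [X in _ * X]ger0_norm ?invr_ge0 ?(ltW e20)// ler_pdivrMr//.
move: (sE t) (sE (t + e)) (sE (t - e)); rewrite !ler_norml; lra.
Qed.

End dens.

(** The factors are replaced one at a time; passing to an enumeration of [I] makes this an
    induction. *)
Lemma prod_dist (R : realType) (I : finType) (a b : I -> R) (B eta : R) :
  1 <= B -> 0 <= eta ->
  (forall i, `|a i| <= B) -> (forall i, `|b i| <= B) ->
  (forall i, `|a i - b i| <= eta) ->
  `|\prod_i a i - \prod_i b i| <= #|I|%:R * B ^+ #|I| * eta.
Proof.
move=> B1 eta0 aB bB ab; have B0 : 0 <= B by exact: le_trans B1.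
rewrite [X in `|X - _|]big_enum_val [X in `|_ - X|]big_enum_val/=.
move: #|I| (@enum_val I I) => n v.
elim: n v => [|n IH] v.
  by rewrite !big_ord0 subrr normr0 mul0r mul0r.
rewrite !big_ord_recl.
move: (IH (fun i => v (lift ord0 i))) (v ord0) => {}IH v0.
set p := \prod_i a _ in IH *; set q := \prod_i b _ in IH *.
have qB : `|q| <= B ^+ n.
  rewrite /q normr_prod -[in leRHS](card_ord n) -prodr_const.
  by apply: ler_prod => i _; rewrite normr_ge0 bB.
have -> : a v0 * p - b v0 * q = a v0 * (p - q) + (a v0 - b v0) * q by ring.
apply: le_trans (ler_normD _ _) _; rewrite !normrM.
have -> : n.+1%:R * B ^+ n.+1 * eta = B * (n%:R * B ^+ n * eta) + eta * B ^+ n.+1.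
  by rewrite exprS -natr1; ring.
apply: lerD; apply: ler_pM => //.
by apply: le_trans qB _; rewrite exprS ler_peMl// exprn_ge0.
Qed.

Lemma eq_cvg_gt0 (R : realType) (u v : nat -> R) (l : R) :
  (forall N, (0 < N)%N -> u N = v N) ->
  v N @[N --> \oo] --> l -> u N @[N --> \oo] --> l.
Proof.
move=> uv; apply: cvg_trans; apply: near_eq_cvg; exists 1%N => // N N0.
by rewrite /= uv.
Qed.

(** * Weyl's argument for products over the coordinates *)

Section weyl.
Context {R : realType} (d : nat) (alpha : 'I_d -> R).
Hypothesis alpha_indep : forall (m : 'I_d -> int) (p : int),
  \sum_i (m i)%:~R * alpha i = p%:~R -> forall i, m i = 0.

(** The product-to-sum formula merges each cosine of the product into the leading phase, changing
    [m] only at coordinates in [s]. Coordinate [i] is not in [s], so [m i] remains nonzero and the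
    final phases are not integers. *)
Lemma diff_avg_prod_cos (f : 'I_d -> nat) (m : 'I_d -> int) (s : seq 'I_d) i :
  i \notin s -> m i != 0 ->
  diff_avg (fun z => cos (tau * ((\sum_j (m j)%:~R * alpha j) * z)) *
     \prod_(j <- s) cos (tau * ((f j)%:R * (alpha j * z)))) N
    @[N --> \oo] --> (0 : R).
Proof.
elim: s m => [|j s IH] m.
  move=> _ mi; under [X in X @ _]eq_fun => N do
    under [X in diff_avg X]eq_fun do rewrite big_nil mulr1.
  apply: diff_avg_cos => p; apply/eqP => /alpha_indep /(_ i) mi0.
  by rewrite mi0 eqxx in mi.
rewrite inE negb_or => /andP[ij /IH {}IH] mi.
pose m1 k : int := m k + (k == j)%:R * (f j)%:Z.
pose m2 k : int := m k - (k == j)%:R * (f j)%:Z.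
have delta (k : int) : \sum_l ((l == j)%:R * k)%:~R * alpha l = k%:~R * alpha j.
  rewrite (bigD1 j)//= eqxx mul1r big1 ?addr0// => l /negbTE->.
  by rewrite mul0r mul0r.
have E1 : \sum_k (m1 k)%:~R * alpha k =
          \sum_k (m k)%:~R * alpha k + (f j)%:R * alpha j.
  rewrite -[(f j)%:R]/((f j)%:Z%:~R) -delta -big_split; apply: eq_bigr => k _.
  by rewrite /m1 intrD mulrDl.
have E2 : \sum_k (m2 k)%:~R * alpha k =
          \sum_k (m k)%:~R * alpha k - (f j)%:R * alpha j.
  rewrite -[(f j)%:R]/((f j)%:Z%:~R) -delta -sumrB; apply: eq_bigr => k _.
  by rewrite /m2 intrB mulrBl.
have m1i : m1 i != 0 by rewrite /m1 (negbTE ij) mul0r addr0.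
have m2i : m2 i != 0 by rewrite /m2 (negbTE ij) mul0r subr0.
pose u m N := diff_avg (fun z => cos (tau * ((\sum_k (m k)%:~R * alpha k) * z)) *
  \prod_(k <- s) cos (tau * ((f k)%:R * (alpha k * z)))) N.
apply: (@eq_cvg_gt0 _ _ (fun N => 2^-1 * (u m1 N + u m2 N))) => [N _|]; last first.
  rewrite -[X in _ --> X](mulr0 (2^-1)); apply: cvgM; first exact: cvg_cst.
  by rewrite -[X in _ --> X](addr0 0); apply: cvgD; exact: IH.
rewrite /u -diff_avgD -diff_avgZ; congr (diff_avg _ N); apply/funext => z.
rewrite big_cons mulrA cosMcos E1 E2 -!mulrDr.
have -> : (\sum_k (m k)%:~R * alpha k) * z + (f j)%:R * (alpha j * z) =
  (\sum_k (m k)%:~R * alpha k + (f j)%:R * alpha j) * z by ring.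
rewrite -!mulrBr.
have -> : (\sum_k (m k)%:~R * alpha k) * z - (f j)%:R * (alpha j * z) =
  (\sum_k (m k)%:~R * alpha k - (f j)%:R * alpha j) * z by ring.
by ring.
Qed.

(** The product is expanded over all choices [f] of one term per coordinate. Choosing the constant 1
    everywhere contributes 1; any other choice has a nonconstant cosine or a zero coefficient at
    some coordinate. *)
Lemma diff_avg_prod_cos_sum (s : seq (R * nat)) :
  (forall p, p \in s -> p.2 = 0%N -> p.1 = 0) ->
  diff_avg (fun z => \prod_i (1 + cos_sum s (alpha i * z))) N
    @[N --> \oo] --> (1 : R).
Proof.
move=> s0; pose s' := (1, 0%N) :: s; pose c (j : 'I_(size s')) := tnth (in_tuple s') j.
have cE t : 1 + cos_sum s t = \sum_j (c j).1 * cos (tau * ((c j).2%:R * t)).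
  rewrite -(big_tnth _ _ _ predT (fun p => p.1 * cos (tau * (p.2%:R * t)))).
  by rewrite big_cons/= mul0r mulr0 cos0 mulr1.
pose T (f : {ffun 'I_d -> 'I_(size s')}) z :=
  \prod_i ((c (f i)).1 * cos (tau * ((c (f i)).2%:R * (alpha i * z)))).
have E N : diff_avg (fun z => \prod_i (1 + cos_sum s (alpha i * z))) N =
           \sum_f diff_avg (T f) N.
  rewrite -diff_avg_sum; congr (diff_avg _ N); apply/funext => z.
  under eq_bigr do rewrite cE.
  exact: bigA_distr_bigA.
under [X in X @ _]eq_fun do rewrite E.
pose f0 : {ffun 'I_d -> 'I_(size s')} := [ffun=> ord0].
have -> : (1 : R) = \sum_(f : {ffun 'I_d -> 'I_(size s')}) (f == f0)%:R.
  by rewrite (bigD1 f0)//= eqxx big1 ?addr0// => f /negbTE->.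
apply: cvg_big => [|f _]; first exact: add_continuous.
have [->|/eqP ff0] := eqVneq f f0.
  apply: (@eq_cvg_gt0 _ _ (fun=> 1)) => [N N0|]; last exact: cvg_cst.
  rewrite -[RHS](@diff_avg_cst R 1 N)//.
  congr (diff_avg _ N); apply/funext => z; rewrite /T big1// => i _.
  by rewrite ffunE /c (tnth_nth (1, 0%N))/= mul0r mulr0 cos0 mulr1.
have [i fi] : exists i, f i != ord0.
  apply: contrapT => H; apply: ff0; apply/ffunP => i; rewrite ffunE.
  by apply: contrapT => /eqP fi; apply: H; exists i.
have TE : T f = fun z => (\prod_i (c (f i)).1) * \prod_i cos (tau * ((c (f i)).2%:R * (alpha i * z))).
  by apply/funext => z; rewrite /T big_split.
rewrite TE; under [X in X @ _]eq_fun do rewrite diff_avgZ.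
(* A term of [s] with frequency 0 has coefficient 0 by [s0], which kills the whole product. *)
have [c2|c2] := eqVneq (c (f i)).2 0%N.
  rewrite (bigD1 i)//= s0//; last first.
    rewrite /c (tnth_nth (1, 0%N)) /=; case: (f i) fi => -[//|n] /= ns _.
    exact: mem_nth.
  by under [X in X @ _]eq_fun do rewrite !mul0r; exact: cvg_cst.
set w := diff_avg _.
suff H : w N @[N --> \oo] --> (0 : R).
  have : (\prod_i (c (f i)).1) * w N @[N --> \oo] --> (\prod_i (c (f i)).1) * 0.
    by apply: cvgM H; exact: cvg_cst.
  by rewrite mulr0.
(* The cosine at coordinate [i] serves as the leading phase; the other coordinates form the list to
   be merged. *)
pose m k : int := (k == i)%:R * (c (f i)).2%:Z.
have mE : \sum_k (m k)%:~R * alpha k = (c (f i)).2%:R * alpha i.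
  rewrite (bigD1 i)//= {1}/m eqxx mul1r big1 ?addr0// => l /negbTE li.
  by rewrite /m li !mul0r.
have mi : m i != 0 by rewrite /m eqxx mul1r.
have := @diff_avg_prod_cos (fun k => (c (f k)).2) m [seq k <- index_enum 'I_d | k != i] i.
rewrite mem_filter eqxx => /(_ isT mi); rewrite mE.
apply: eq_cvg_gt0 => N _; congr (diff_avg _ N).
by apply/funext => z; rewrite big_filter -[_ * alpha i * z]mulrA; exact: bigD1.
Qed.

Lemma diff_avg_prod_dens e : 0 < e ->
  diff_avg (fun z => \prod_i dens e (alpha i * z)) N @[N --> \oo] --> (1 : R).
Proof.
move=> e0; apply/cvgrPdist_le => /= eta eta0.
(* [1 + e^-2] bounds [dens]; one more unit covers its approximant, as [eta' <= 1]. *)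
pose B := 2 + e ^- 2.
have e2 : 0 <= e ^- 2 by rewrite invr_ge0 sqr_ge0.
have B1 : 1 <= B by rewrite /B; lra.
pose D := d%:R * B ^+ d.
have D0 : 0 <= D by rewrite mulr_ge0// exprn_ge0//; lra.
pose eta' := Num.min 1 (eta / (2 * (D + 1))).
have D1 : 0 < 2 * (D + 1) by lra.
have eta'0 : 0 < eta' by rewrite lt_min ltr01 divr_gt0.
have eta'1 : eta' <= 1 by rewrite ge_min lexx.
have eta'D : eta' <= eta / (2 * (D + 1)) by rewrite ge_min lexx orbT.
have {}eta'D : D * eta' <= eta / 2.
  have : eta' * (2 * (D + 1)) <= eta by rewrite -ler_pdivlMr.
  nra.
have [s s0 sE] := dens_approx e0 eta'0.
have /cvgrPdist_le /(_ (eta / 2)) := diff_avg_prod_cos_sum s0.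
rewrite divr_gt0// => /(_ isT); apply: filterS => N HN.
rewrite (splitr eta); apply: le_trans (ler_distD _ _ _) (lerD HN _).
apply: le_trans eta'D; apply: diff_avg_dist => [|z]; first by rewrite mulr_ge0// ltW.
rewrite /D -[d in d%:R]card_ord -[d in B ^+ d]card_ord.
apply: prod_dist => // [|i|i|i].
- exact: ltW.
- have -> : 1 + cos_sum s (alpha i * z) = dens e (alpha i * z) -
     (dens e (alpha i * z) - (1 + cos_sum s (alpha i * z))) by ring.
  apply: le_trans (ler_normB _ _) _.
  have := sE (alpha i * z); have := dens_norm_le (alpha i * z) e0; rewrite /B; lra.
- have := dens_norm_le (alpha i * z) e0; rewrite /B; lra.
- by rewrite distrC.
Qed.

End weyl.

(** * One coordinate *)

Section triangle.
Context {R : realType}.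
Implicit Types (u e b w t : R).

Lemma chiDnat t n : chi (t + n%:R) = chi t.
Proof.
have -> : n%:R = (n%:Z)%:~R :> R by [].
rewrite /chi /frac floorDrz ?intr_int// intrKfloor intrD.
by congr (_ * _); ring.
Qed.

Lemma densDnat e t n : dens e (t + n%:R) = dens e t.
Proof.
rewrite /dens; have -> : t + n%:R + e = t + e + n%:R by ring.
have -> : t + n%:R - e = t - e + n%:R by ring.
by rewrite !chiDnat.
Qed.

Lemma sum_natB u n : \sum_(j < n) (u - j%:R) = n%:R * u - n%:R * (n%:R - 1) / 2.
Proof.
elim: n => [|n IH]; first by rewrite big_ord0; field.
by rewrite big_ord_recr/= IH -[n.+1%:R]natr1; field.
Qed.

(** The left side is affine between consecutive integers and agrees with the quadratic at integers;
    [chi] is the gap between a parabola of leading coefficient 1 and its chords. *)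
Lemma sum_dist_nat u L : 0 <= u <= L%:R ->
  \sum_(j < L.+1) `|u - j%:R| = u ^+ 2 - u * L%:R + L%:R * (L%:R + 1) / 2 + chi u.
Proof.
elim: L => [|L IH] => /andP[u0 uL].
  have -> : u = 0 by lra.
  by rewrite big_ord1 subrr normr0 /chi /frac floor0 subrr; field.
rewrite big_ord_recr/=; have [uL'|uL'] := leP u L%:R.
  rewrite IH ?u0// -[L.+1%:R]natr1 ler0_norm; last lra.
  by field.
have -> : chi u = (u - L%:R) * (L%:R + 1 - u).
  (* At the right endpoint the fractional part is 0 and no longer [u - L], but both formulas give
     0. *)
  have [->|uneq] := eqVneq u L.+1%:R.
    by rewrite -[L.+1%:R]add0r chiDnat /chi /frac floor0 subrr -natr1; ring.
  rewrite /chi /frac (@floor_def _ _ L%:Z); first by rewrite -pmulrn; ring.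
  rewrite intrD -!pmulrn (ltW uL') /=.
  by move: uneq uL; rewrite lt_neqAle -natr1 => -> ->.
rewrite (eq_bigr (fun j : 'I_L.+1 => u - j%:R)); last first.
  move=> j _; rewrite ger0_norm// subr_ge0 (le_trans _ (ltW uL'))// ler_nat.
  by rewrite -ltnS.
by rewrite sum_natB distrC ger0_norm ?subr_ge0// -natr1; field.
Qed.

(** The density of [U - V] for independent [U] and [V] uniform on [[0, 1]]. *)
Definition tri b := Num.max 0 (1 - `|b|).

Lemma triE b : tri b = (`|b + 1| - 2 * `|b| + `|b - 1|) / 2.
Proof.
rewrite /tri; case: (ler0P (b + 1)) => ?; case: (ler0P b) => ?;
  case: (ler0P (b - 1)) => ?; case: leP => ?; lra.
Qed.

Lemma tri_ge0 b : 0 <= tri b.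
Proof. by rewrite le_max lexx. Qed.

(** By [triE] the sum is a second difference of the sums of [sum_dist_nat], whose three arguments
    lie in [[0, L]]. The quadratic part contributes [2 e^2], whence the constant 1 of [dens]. *)
Lemma sum_tri e u L : 0 < e -> e <= u -> u + e <= L%:R ->
  \sum_(j < L.+1) tri ((u - j%:R) / e) = e * dens e u.
Proof.
move=> e0 eu uL.
pose S (v : R) := \sum_(j < L.+1) `|v - j%:R|.
have -> : \sum_(j < L.+1) tri ((u - j%:R) / e) =
    (S (u + e) - 2 * S u + S (u - e)) / (2 * e).
  rewrite mulr_sumr -sumrB -big_split/= mulr_suml; apply: eq_bigr => j _.
  have nE v : `|v / e| = `|v| / e by rewrite normrM [X in _ * X]gtr0_norm ?invr_gt0.
  rewrite triE.
  have -> : (u - j%:R) / e + 1 = (u + e - j%:R) / e by field; rewrite gt_eqF.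
  have -> : (u - j%:R) / e - 1 = (u - e - j%:R) / e by field; rewrite gt_eqF.
  by rewrite !nE; field; rewrite gt_eqF.
rewrite /S !sum_dist_nat; [|lra..].
by rewrite /dens; field; rewrite gt_eqF.
Qed.

(** The difference of the endpoints of the set of [x] in [[0, 1]] for which [[b + x - w, b + x + w]]
    meets [[0, 1]]. In [overlap_ge] it is required to be contained in [[0, 1]]. *)
Lemma overlap_le b w : 0 < w ->
  Num.min 1 (1 - b + w) - Num.max 0 (- b - w) <= tri b + 2 * w.
Proof.
move=> w0; set m := Num.min _ _; set M := Num.max _ _.
have m1 : m <= 1 by rewrite ge_min lexx.
have m2 : m <= 1 - b + w by rewrite ge_min lexx orbT.
have M1 : 0 <= M by rewrite le_max lexx.
have M2 : - b - w <= M by rewrite le_max lexx orbT.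
have : 1 - `|b| <= tri b by rewrite le_max lexx orbT.
by case: (ler0P b) => ?; lra.
Qed.

Lemma overlap_ge b w : 0 < w ->
  tri b - 2 * w <= Num.max 0 (Num.min 1 (1 - b - w) - Num.max 0 (w - b)).
Proof.
move=> w0; rewrite le_max; apply/orP.
have [b1|b1] := leP 1 `|b|.
  by left; rewrite /tri; case: (leP 0 (1 - `|b|)) => ?; lra.
right; have -> : tri b = 1 - `|b| by rewrite /tri; case: (leP 0 (1 - `|b|)) => ?; lra.
by case: (leP 0 (w - b)) => ?; case: (leP 1 (1 - b - w)) => ?; case: (ler0P b) => ?; lra.
Qed.

Lemma tri_ge_half b B : 0 < B -> `|b| <= B -> 1 <= 2 * tri (b / (2 * B)).
Proof.
move=> B0 bB; have h : `|b / (2 * B)| <= 2^-1.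
  rewrite normrM [X in _ * X]gtr0_norm ?invr_gt0 ?mulr_gt0// ler_pdivrMr ?mulr_gt0//.
  lra.
by rewrite /tri; case: (leP 0 (1 - `|b / (2 * B)|)) => ?; lra.
Qed.

End triangle.

Section measurability.
Context (disp : measure_display) (T : measurableType disp) (R : realType).
Implicit Types (u v : T -> R).

Lemma measurable_set_le u v : measurable_fun [set: T] u ->
  measurable_fun [set: T] v -> measurable [set x | u x <= v x].
Proof.
move=> mu mv; rewrite -[X in measurable X]setTI.
have -> : [set x | u x <= v x] = (fun x => u x <= v x) @^-1` [set true].
  by apply/seteqP; split => x.
exact: measurable_fun_ler.
Qed.

Lemma measurable_near_int u v (t e delta : R) : measurable_fun [set: T] u ->
  measurable_fun [set: T] v ->
  measurable [set x | exists m : int, `|t + e * (u x - v x) - m%:~R| <= delta].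
Proof.
move=> mu mv.
have -> : [set x | exists m : int, `|t + e * (u x - v x) - m%:~R| <= delta] =
    \bigcup_(m : int) [set x | `|t + e * (u x - v x) - m%:~R| <= delta].
  by apply/seteqP; split => x [m]; [exists m|move=> _; exists m].
apply: countable_bigcupT_measurable => // m; apply: measurable_set_le => //.
apply: measurableT_comp => //; apply: measurable_funB => //.
by apply: measurable_funD => //; apply: measurable_funM => //; exact: measurable_funB.
Qed.

End measurability.

(** * The measure of the close pairs in the unit square *)

Section close_pairs.
Context {R : realType}.
Implicit Types (t e delta b w x y : R).
Local Notation lam := (@lebesgue_measure R).
Let R2 : Type := (measurableTypeR R * measurableTypeR R)%type.

Definition unit_square : set R2 := [set p | 0 <= (p.1 : R) <= 1 /\ 0 <= (p.2 : R) <= 1].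

Definition close_pairs t e delta : set R2 := unit_square `&`
  [set p | exists m : int, `|t + e * ((p.1 : R) - p.2) - m%:~R| <= delta].

(** The part of [close_pairs] belonging to one integer, after division by [e]. *)
Definition strip b w : set R2 :=
  unit_square `&` [set p | `|b + ((p.1 : R) - p.2)| <= w].

Let mfst : measurable_fun [set: R2] (fun p : R2 => p.1 : R).
Proof. exact: (@measurable_fst _ _ (measurableTypeR R) (measurableTypeR R)). Qed.

Let msnd : measurable_fun [set: R2] (fun p : R2 => p.2 : R).
Proof. exact: (@measurable_snd _ _ (measurableTypeR R) (measurableTypeR R)). Qed.

Lemma measurable_unit_square : measurable unit_square.
Proof.
have -> : unit_square = ([set p | (0 : R) <= (p.1 : R)] `&` [set p | (p.1 : R) <= (1 : R)])
    `&` ([set p | (0 : R) <= (p.2 : R)] `&` [set p | (p.2 : R) <= (1 : R)]).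
  apply/seteqP; split => p.
    by move=> [/andP[? ?] /andP[? ?]].
  by move=> [[/= ? ?] [/= ? ?]]; split; apply/andP.
by apply: measurableI; apply: measurableI; exact: measurable_set_le.
Qed.

Lemma measurable_close_pairs t e delta : measurable (close_pairs t e delta).
Proof.
apply: measurableI; first exact: measurable_unit_square.
exact: measurable_near_int.
Qed.

Lemma measurable_strip b w : measurable (strip b w).
Proof.
apply: measurableI; first exact: measurable_unit_square.
apply: measurable_set_le => //; apply: measurableT_comp => //.
by apply: measurable_funD => //; exact: measurable_funB.
Qed.

Lemma lebesgue_measure_cc (a b : R) : lam `[a, b]%classic = (Num.max 0 (b - a))%:E.
Proof.
rewrite lebesgue_measure_itv/= lte_fin; case: ifPn => ab.
  by rewrite max_r// subr_ge0 ltW.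
by rewrite max_l// subr_le0 leNgt.
Qed.

Lemma lam_xsection_strip_le b w x : 0 < w ->
  (lam (xsection (strip b w) x) <=
   (2 * w)%:E * (\1_`[Num.max 0 (- b - w), Num.min 1 (1 - b + w)] x)%:E)%E.
Proof.
move=> w0; rewrite indicE.
have [xJ|xJ] := boolP (x \in _).
  rewrite mule1 (@le_trans _ _ (lam `[(b + x - w), (b + x + w)]%classic))//.
    apply: le_measure; rewrite ?inE//.
      by apply: measurable_xsection; exact: measurable_strip.
    by move=> y /xsectionP[_ /=]; rewrite in_itv/= ler_norml; lra.
  by rewrite lebesgue_measure_cc lee_fin max_r; lra.
suff -> : xsection (strip b w) x = set0 by rewrite measure0 mule0.
apply/seteqP; split => // y /xsectionP[[/= x01 y01]]; rewrite ler_norml => ?.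
move/negP: xJ; apply; rewrite inE /= in_itv/= ge_max le_min; lra.
Qed.

Lemma lam_xsection_strip_ge b w x : 0 < w ->
  ((2 * w)%:E * (\1_`[Num.max 0 (w - b), Num.min 1 (1 - b - w)] x)%:E <=
   lam (xsection (strip b w) x))%E.
Proof.
move=> w0; rewrite indicE.
have [|xJ] := boolP (x \in _); last by rewrite mule0.
rewrite inE/= in_itv/= ge_max le_min => xJ.
rewrite mule1 (@le_trans _ _ (lam `[(b + x - w), (b + x + w)]%classic))//.
  by rewrite lebesgue_measure_cc lee_fin max_r; lra.
apply: le_measure; rewrite ?inE//.
  by apply: measurable_xsection; exact: measurable_strip.
move=> y /=; rewrite in_itv/= => ?; apply/xsectionP; split; first by split => /=; lra.
by rewrite /= ler_norml; lra.
Qed.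

Lemma strip_eq0 b w : 1 + w < `|b| -> strip b w = set0.
Proof.
move=> bw; apply/seteqP; split => // -[x y] [[/= x01 y01]] /=.
rewrite ler_norml => xy.
by move: bw; case: (ler0P b) => ? ?; lra.
Qed.

Let m2 := (lam \x lam)%E.

Let integral_step a (J : set (measurableTypeR R)) : 0 <= a -> measurable J ->
  (\int[lam]_x (a%:E * (\1_J x)%:E) = a%:E * lam J)%E.
Proof.
move=> a0 mJ; rewrite ge0_integralZl//; last exact/measurable_EFinP.
by rewrite integral_indic// setIT.
Qed.

Lemma strip_le b w : 0 < w -> (m2 (strip b w) <= (2 * w * (tri b + 2 * w))%:E)%E.
Proof.
move=> w0; rewrite /m2 /product_measure1.
pose J := `[Num.max 0 (- b - w), Num.min 1 (1 - b + w)]%classic.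
apply: (@le_trans _ _ (\int[lam]_x ((2 * w)%:E * (\1_J x)%:E))%E).
  apply: ge0_le_integral => //.
  - by apply: measurable_fun_xsection; exact: measurable_strip.
  - apply: measurable_funeM; apply/measurable_EFinP; apply: measurable_indic.
    exact: measurable_itv.
  - by move=> x _; exact: lam_xsection_strip_le.
rewrite integral_step ?mulr_ge0 ?(ltW w0)//; last exact: measurable_itv.
rewrite lebesgue_measure_cc -EFinM lee_fin.
rewrite ler_wpM2l ?mulr_ge0 ?(ltW w0)// ge_max overlap_le// andbT.
by rewrite addr_ge0 ?tri_ge0 ?mulr_ge0// ltW.
Qed.

Lemma strip_ge b w : 0 < w -> ((2 * w * (tri b - 2 * w))%:E <= m2 (strip b w))%E.
Proof.
move=> w0; rewrite /m2 /product_measure1.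
pose J := `[Num.max 0 (w - b), Num.min 1 (1 - b - w)]%classic.
apply: (@le_trans _ _ (\int[lam]_x ((2 * w)%:E * (\1_J x)%:E))%E); last first.
  apply: ge0_le_integral => //.
  - by move=> x _; rewrite mule_ge0// lee_fin mulr_ge0// ltW.
  - apply: measurable_funeM; apply/measurable_EFinP; apply: measurable_indic.
    exact: measurable_itv.
  - by apply: measurable_fun_xsection; exact: measurable_strip.
  - by move=> x _; exact: lam_xsection_strip_ge.
rewrite integral_step ?mulr_ge0 ?(ltW w0)//; last exact: measurable_itv.
rewrite lebesgue_measure_cc -EFinM lee_fin.
by rewrite ler_wpM2l ?mulr_ge0 ?(ltW w0)// overlap_ge.
Qed.

(* The factor [2 * tri (b / (2 * B))] dominates the indicator of [|b| <= B];
   it makes the errors summable over translates of [b]. *)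
Lemma strip_measure b w B : 0 < w -> 1 + w <= B ->
  m2 (strip b w) \is a fin_num /\
  `|fine (m2 (strip b w)) - 2 * w * tri b| <= 8 * w ^+ 2 * tri (b / (2 * B)).
Proof.
move=> w0 wB; have B0 : 0 < B by lra.
have [bw|bw] := ltP (1 + w) `|b|.
  rewrite strip_eq0// /m2 measure0; split => //=.
  have -> : tri b = 0 by rewrite /tri max_l//; lra.
  by rewrite mulr0 subrr normr0 mulr_ge0 ?tri_ge0// mulr_ge0 ?sqr_ge0.
have h := strip_le b w0; have h' := strip_ge b w0.
have fin : m2 (strip b w) \is a fin_num.
  by rewrite ge0_fin_numE ?measure_ge0// (le_lt_trans h) ?ltry.
split => //; move: h h'; rewrite -(fineK fin) !lee_fin /= => h h'.
have := tri_ge_half B0 (le_trans bw wB); set T := tri (b / _) => T1.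
have : 4 * w ^+ 2 <= 8 * w ^+ 2 * T.
  have : 0 <= 4 * w ^+ 2 by rewrite mulr_ge0 ?sqr_ge0.
  by move: (w ^+ 2) => q ?; nra.
rewrite ler_norml; move: h h'; rewrite !(mulrDr, mulrN) expr2 => h h' k; lra.
Qed.

Let translate_eq e t x y (c delta : R) : 0 < e ->
  (`|t + e * (x - y) - c| <= delta) = (`|(t - c) / e + (x - y)| <= delta / e).
Proof.
move=> e0.
have -> : t + e * (x - y) - c = ((t - c) / e + (x - y)) * e.
  by field; rewrite gt_eqF.
by rewrite normrM (gtr0_norm e0) ler_pdivlMr.
Qed.

(** On the unit square [|t + e (x - y)| <= |t| + e], so only integers [m] with [|m| <= K] occur;
    they are indexed by [j = m + K]. *)
Lemma close_pairsE t e delta K : 0 < e -> delta <= 1 -> `|t| + e + 1 <= K%:R ->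
  close_pairs t e delta =
  \big[setU/set0]_(j < K.*2.+1) strip ((t + K%:R - j%:R) / e) (delta / e).
Proof.
move=> e0 d1 tK; rewrite -(bigcup_mkord _ (fun j => strip ((t + K%:R - j%:R) / e) (delta / e))).
apply/seteqP; split => -[x y].
- move=> [[/= x01 y01] [m mE]].
  have mK : `|m%:~R| <= K%:R :> R.
    move: mE tK; rewrite !ler_norml; case: (ler0P t) => ? ? ?; nra.
  have mK' : (0 <= m + K%:Z) && (m + K%:Z <= K.*2%:Z).
    have /andP[] : (- K%:Z <= m) && (m <= K%:Z).
      by rewrite -!(ler_int R) mulrNz -!pmulrn -ler_norml.
    by rewrite -addnn PoszD; lia.
  case/andP: mK' => mK0 mK2.
  exists (absz (m + K%:Z)); first by rewrite /= ltnS -lez_nat gez0_abs.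
  split; first by split.
  rewrite /= in mE *.
  have -> : (absz (m + K%:Z))%:R = m%:~R + K%:R :> R.
    by rewrite pmulrn gez0_abs// intrD -pmulrn.
  have -> : t + K%:R - (m%:~R + K%:R) = t - m%:~R by ring.
  by rewrite -translate_eq.
- move=> [j _ [[/= x01 y01]]] /= jE; split; first by split.
  exists (j%:Z - K%:Z); rewrite translate_eq// intrB -!pmulrn.
  by have -> : t - (j%:R - K%:R) = t + K%:R - j%:R by ring.
Qed.

(** A real number is within [delta < 1/2] of at most one integer. *)
Let strip_trivIset (u e delta : R) : 0 < e -> delta < 2^-1 ->
  trivIset [set: nat] (fun j => strip ((u - j%:R) / e) (delta / e)).
Proof.
move=> e0 d2; apply/trivIsetP => i j _ _ ij.
apply/seteqP; split => // -[x y] [[_ /=] iE] [_ /=] jE.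
rewrite -!translate_eq// in iE jE.
have {iE jE} : `|i%:R - j%:R| < 1 :> R.
  by move: iE jE; rewrite !ler_norml ltr_norml => ? ?; lra.
move=> ij1; move/eqP : ij; apply; apply/eqP.
have : `|(i%:Z - j%:Z)%:~R| < 1%:~R :> R by rewrite intrB -!pmulrn.
by rewrite -intr_norm ltr_int; lia.
Qed.

Variable e : R.
Hypothesis e0 : 0 < e.
(** Chosen together with [B] so that [2 e B = E]: the dominating triangles then form a sum as in
    [sum_tri], of step [E]. [B] bounds [1 + delta / e] for [delta <= 1]. *)
Let E := 2 * (e + 1).
Let E0 : 0 < E. Proof. by rewrite mulr_gt0// addr_gt0. Qed.
Let B := 1 + e^-1.

(** Large enough for [sum_tri] to apply at [shift t] with both steps [e] and [E]. *)
Let width t := (Num.truncn (`|t| + E)).+1.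

Let width_ge t : `|t| + E <= (width t)%:R.
Proof. exact/ltW/truncnS_gt. Qed.

Let shift t := t + (width t)%:R.

Let shift_itv t : E <= shift t /\ shift t + E <= (width t).*2%:R.
Proof.
rewrite -muln2 natrM /shift; move: ((width t)%:R : R) (width_ge t) => W.
have := ler_norm t; have := lerNnormlW (lexx `|t|).
by move: `|t| => a; move: E => E' *; split; lra.
Qed.

Let sum_tri_shift t :
  \sum_(j < (width t).*2.+1) tri ((shift t - j%:R) / e) = e * dens e t.
Proof.
have [h h'] := shift_itv t; have eE : e <= E by have := e0; rewrite /E; lra.
rewrite sum_tri//; [by rewrite /shift densDnat|exact: le_trans h|].
by apply: le_trans h'; rewrite lerD2l.
Qed.

Let sum_tri_err t :
  \sum_(j < (width t).*2.+1) tri ((shift t - j%:R) / e / (2 * B)) <= E * (1 + E ^- 2).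
Proof.
have EE (x : R) : x / e / (2 * B) = x / E.
  by rewrite /E /B; field; rewrite !gt_eqF// ?addr_gt0.
under eq_bigr do rewrite EE.
have [h h'] := shift_itv t; rewrite sum_tri// /shift densDnat.
by rewrite ler_wpM2l ?(ltW E0)// (le_trans (ler_norm _))// dens_norm_le.
Qed.

Let close_pairs_strips t delta : delta <= 1 -> close_pairs t e delta =
  \big[setU/set0]_(j < (width t).*2.+1) strip ((shift t - j%:R) / e) (delta / e).
Proof.
move=> d1; apply: close_pairsE => //; apply: le_trans (width_ge t).
by have := e0; rewrite /E; lra.
Qed.

(** The bound is uniform in [t] and [x]; it later controls two events sharing an index, by
    conditioning on the common vector. A union bound over the strips suffices. *)
Lemma lam_xsection_close_pairs t delta x : 0 < delta <= 1 ->
  (lam (xsection (close_pairs t e delta) x) <= (4 / e * (E * (1 + E ^- 2)) * delta)%:E)%E.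
Proof.
move=> /andP[d0 d1]; have w0 : 0 < delta / e by rewrite divr_gt0.
rewrite close_pairs_strips//.
pose S j := strip ((shift t - j%:R) / e) (delta / e).
have -> : xsection (\big[setU/set0]_(j < (width t).*2.+1) S j) x =
    \big[setU/set0]_(j < (width t).*2.+1) xsection (S j) x.
  rewrite -(bigcup_mkord _ S) -(bigcup_mkord _ (fun j => xsection (S j) x)); apply/seteqP; split => y.
    by move=> /xsectionP[j ? ?]; exists j => //; apply/xsectionP.
  by move=> [j ? /xsectionP ?]; apply/xsectionP; exists j.
have mS j : measurable (xsection (S j) x).
  by apply: measurable_xsection; exact: measurable_strip.
have := @le_mu_bigsetU _ _ _ lam _ (width t).*2.+1 (fun j _ => mS j).
move=> /le_trans; apply.
apply: (@le_trans _ _ (\sum_(j < (width t).*2.+1)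
    (4 * (delta / e) * tri ((shift t - j%:R) / e / (2 * B)))%:E)%E).
  apply: lee_sum => j _; rewrite /S; move: (_ / e) => b.
  have [bw|bw] := ltP (1 + delta / e) `|b|.
    rewrite strip_eq0// xsection0 measure0 lee_fin mulr_ge0 ?tri_ge0//.
    by rewrite mulr_ge0// ltW.
  apply: le_trans (lam_xsection_strip_le b x w0) _.
  rewrite -EFinM lee_fin indicE (@le_trans _ _ (2 * (delta / e)))//.
    have le1 (c : bool) : c%:R <= 1 :> R by case: c.
    by rewrite ler_piMr// mulr_ge0// ltW.
  have B0 : 0 < B by rewrite addr_gt0 ?invr_gt0.
  have bB : `|b| <= B.
    by apply: le_trans bw _; rewrite lerD2l// ler_pdivrMr// mulVf// gt_eqF.
  have := tri_ge_half B0 bB; move: (tri _) => T T1; nra.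
rewrite sumEFin lee_fin -mulr_sumr (@le_trans _ _ (4 * (delta / e) * (E * (1 + E ^- 2))))//.
  by rewrite ler_wpM2l ?sum_tri_err// mulr_ge0// ltW.
by rewrite le_eqVlt; apply/orP; left; apply/eqP; ring.
Qed.

(** The strips are disjoint and their main terms add up by [sum_tri]. Their number grows with [|t|],
    but the dominating triangles keep the total error [O (delta^2)] uniformly in [t]. *)
Lemma close_pairs_measure t delta : 0 < delta < 2^-1 ->
  m2 (close_pairs t e delta) \is a fin_num /\
  `|fine (m2 (close_pairs t e delta)) - 2 * delta * dens e t| <=
    8 / e ^+ 2 * (E * (1 + E ^- 2)) * delta ^+ 2.
Proof.
move=> /andP[d0 d2]; have w0 : 0 < delta / e by rewrite divr_gt0.
have d1 : delta <= 1 by lra.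
pose S j := strip ((shift t - j%:R) / e) (delta / e).
have wB : 1 + delta / e <= B by rewrite lerD2l ler_pdivrMr// mulVf// gt_eqF.
have SE j := strip_measure ((shift t - j%:R) / e) w0 wB.
have -> : m2 (close_pairs t e delta) =
    (\sum_(j < (width t).*2.+1) (fine (m2 (S j)))%:E)%E.
  rewrite close_pairs_strips// /m2 (@measure_bigsetU _ _ _ (lam \x lam)%E S)//.
  - by apply: eq_bigr => j _; rewrite fineK//; case: (SE j).
  - by move=> j; exact: measurable_strip.
  - exact: strip_trivIset.
rewrite sumEFin; split => //=.
have -> : 2 * delta * dens e t =
    \sum_(j < (width t).*2.+1) 2 * (delta / e) * tri ((shift t - j%:R) / e).
  by rewrite -mulr_sumr sum_tri_shift; field; rewrite gt_eqF.
rewrite -sumrB; apply: le_trans (ler_norm_sum _ _ _) _.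
apply: (@le_trans _ _ (\sum_(j < (width t).*2.+1)
    8 * (delta / e) ^+ 2 * tri ((shift t - j%:R) / e / (2 * B)))).
  by apply: ler_sum => j _; case: (SE j).
rewrite -mulr_sumr (@le_trans _ _ (8 * (delta / e) ^+ 2 * (E * (1 + E ^- 2))))//.
  by rewrite ler_wpM2l ?sum_tri_err// mulr_ge0// sqr_ge0.
rewrite le_eqVlt; apply/orP; left; apply/eqP; rewrite exprMn exprVn; ring.
Qed.

End close_pairs.

(** * Product laws *)

Section conditional_product.
Context (d0 d1 d2 : measure_display) (Omega : measurableType d0)
  (T1 : measurableType d1) (T2 : measurableType d2) (R : realType).
Local Open Scope ereal_scope.

(* Taking [F] general allows to add the factors of a product measure one after
   the other. *)
Lemma product_law_on (P : probability Omega R) (F : set Omega)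
  (U : Omega -> T1) (V : Omega -> T2)
  (m1 : probability T1 R) (m2 : probability T2 R) :
  measurable F -> measurable_fun [set: Omega] U -> measurable_fun [set: Omega] V ->
  (forall A B, measurable A -> measurable B ->
     P (F `&` (U @^-1` A `&` V @^-1` B)) = P F * (m1 A * m2 B)) ->
  forall S : set (T1 * T2), measurable S ->
    P (F `&` [set w | S (U w, V w)]) = P F * (m1 \x m2) S.
Proof.
move=> mF mU mV FUV S mS.
have mUV : measurable_fun [set: Omega] (fun w => (U w, V w)).
  exact/measurable_fun_pair.
(* [P] restricted to [F] has total mass [P F]; giving this mass to the first factor lets uniqueness
   of product measures apply. *)
pose r : {nonneg R} := NngNum (fine_ge0 (measure_ge0 P F)).
have rE : r%:num%:E = P F by rewrite /= fineK// fin_num_measure.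
pose m' := pushforward (mrestr P mF) (fun w => (U w, V w)).
have m'E A : m' A = P (F `&` [set w | A (U w, V w)]).
  by rewrite /m' /pushforward /mrestr setIC.
have -> : P (F `&` [set w | S (U w, V w)]) = (mscale r m1 \x m2) S.
  rewrite -m'E; apply/esym.
  pose M : {measure set (T1 * T2) -> \bar R} := [the measure _ _ of m'].
  apply: (@product_measure_unique _ _ _ _ _ (mscale r m1) m2 (M mUV)) => // A B mA mB.
  have : m' (A `*` B) = (r%:num%:E * m1 A) * m2 B.
    by rewrite m'E rE -muleA -FUV.
  by [].
rewrite /product_measure1 ge0_integral_mscale//= ?fineK ?fin_num_measure//.
exact: measurable_fun_xsection.
Qed.

End conditional_product.

Section tuple_integrals.
Context {R : realType}.
Local Open Scope ereal_scope.
Local Notation lam := (@lebesgue_measure R).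

Lemma measurable_prode (d0 : measure_display) (T : measurableType d0) n
    (f : 'I_n -> T -> \bar R) : (forall i, measurable_fun [set: T] (f i)) ->
  measurable_fun [set: T] (fun x => \prod_(i < n) f i x).
Proof.
elim: n f => [|n IH] f mf.
  by under eq_fun do rewrite big_ord0; exact: measurable_cst.
under eq_fun do rewrite big_ord_recl.
by apply: emeasurable_funM => //; exact: IH.
Qed.

Lemma measurable_tnthR n (i : 'I_n) :
  measurable_fun [set: n.-tuple R] (fun x => tnth x i : measurableTypeR R).
Proof. exact: (@measurable_tnth _ R). Qed.

(** The induction follows the recursion of [lebesgue_tuple]: it is the image of a product measure,
    and Tonelli's theorem splits off the first coordinate. *)
Lemma integral_prod_tuple n (f : 'I_n -> measurableTypeR R -> \bar R) :
  (forall i, measurable_fun [set: measurableTypeR R] (f i)) ->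
  (forall i x, 0 <= f i x) ->
  \int[lebesgue_tuple n]_x \prod_(i < n) f i (tnth x i) =
  \prod_(i < n) \int[lam]_x f i x.
Proof.
elim: n f => [|n IH] f mf f0.
  rewrite big_ord0; under eq_integral do rewrite big_ord0.
  by rewrite integral_dirac//= diracT mul1e.
pose g (p : measurableTypeR R * n.-tuple R) :=
  f ord0 p.1 * \prod_(i < n) f (lift ord0 i) (tnth p.2 i).
have mprod : measurable_fun [set: n.-tuple R]
    (fun y : n.-tuple R => \prod_(i < n) f (lift ord0 i) (tnth y i)).
  apply: measurable_prode => i.
  exact: (measurableT_comp (mf _) (measurable_tnthR i)).
have prod0 (y : n.-tuple R) : 0 <= \prod_(i < n) f (lift ord0 i) (tnth y i).
  by apply: prode_ge0 => i _; exact: f0.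
have mg : measurable_fun [set: measurableTypeR R * n.-tuple R] g.
  apply: emeasurable_funM; first exact: measurableT_comp.
  exact: (measurableT_comp mprod).
have -> : \int[lebesgue_tuple n.+1]_x \prod_(i < n.+1) f i (tnth x i) =
    \int[lam \x lebesgue_tuple n]_p g p.
  rewrite /= /lebesgue_cons ge0_integral_pushforward//=.
  - apply: eq_integral => -[x y] _ /=; rewrite big_ord_recl /g/=.
    by congr (_ * _); apply: eq_bigr => i _; rewrite tnthS.
  - exact: measurable_cons_pair.
  - apply: measurable_prode => i.
    exact: (measurableT_comp (mf _) (measurable_tnthR i)).
  - by move=> x _; apply: prode_ge0 => i _; exact: f0.
rewrite fubini_tonelli1//; last by move=> p; rewrite mule_ge0.
rewrite big_ord_recl -IH//.
under eq_integral => x _.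
  rewrite /fubini_F /g /= ge0_integralZl//; over.
by rewrite ge0_integralZr//; exact: integral_ge0.
Qed.

Definition coordinatewise n (A : 'I_n -> set (measurableTypeR R * measurableTypeR R)) :
    set (n.-tuple R * n.-tuple R) :=
  [set p | forall i, A i (tnth p.1 i, tnth p.2 i)].

Lemma measurable_coordinatewise n A : (forall i, measurable (A i)) ->
  measurable (@coordinatewise n A).
Proof.
move=> mA; have -> : coordinatewise A =
    \bigcap_(i : 'I_n) [set p | A i (tnth p.1 i, tnth p.2 i)].
  by apply/seteqP; split => [p Ap i _|p Ap i]; exact: Ap.
apply: fin_bigcap_measurable => // i _.
rewrite -[X in measurable X]setTI.
apply: (measurable_fun_pair (f := fun p : n.-tuple R * n.-tuple R =>
  tnth p.1 i : measurableTypeR R) (g := fun p => tnth p.2 i : measurableTypeR R)) => //.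
- by apply: (measurableT_comp (measurable_tnthR i)); exact: measurable_fst.
- by apply: (measurableT_comp (measurable_tnthR i)); exact: measurable_snd.
Qed.

Lemma xsection_coordinatewise n A x :
  (forall i, measurable (A i)) ->
  lebesgue_tuple n (xsection (coordinatewise A) x) =
  \prod_(i < n) lam (xsection (A i) (tnth x i)).
Proof.
move=> mA.
have mB i : measurable (xsection (A i) (tnth x i)) by exact: measurable_xsection.
have mS : measurable (xsection (coordinatewise A) x).
  by apply: measurable_xsection; exact: measurable_coordinatewise.
have -> : lebesgue_tuple n (xsection (coordinatewise A) x) =
    \int[lebesgue_tuple n]_y (\1_(xsection (coordinatewise A) x) y)%:E.
  by rewrite integral_indic// setIT.
transitivity (\int[lebesgue_tuple n]_y \prod_(i < n)
    (\1_(xsection (A i) (tnth x i)) (tnth y i : measurableTypeR R))%:E).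
  apply: eq_integral => y _; rewrite prodEFin; congr EFin; rewrite indicE.
  have [|] := boolP (y \in _).
    rewrite inE => /xsectionP /= xyA.
    by rewrite big1// => i _; rewrite indicE mem_set//; apply/xsectionP; exact: xyA.
  move=> /negP; rewrite inE => nA.
  have [i Ai] : exists i, ~ A i (tnth x i, tnth y i).
    by apply/existsNP => H; apply: nA; apply/xsectionP.
  rewrite (bigD1 i)//= indicE memNset ?mul0r//.
  by move=> /xsectionP.
rewrite (integral_prod_tuple (f := fun i y => (\1_(xsection (A i) (tnth x i)) y)%:E))//.
- by apply: eq_bigr => i _; rewrite integral_indic// setIT.
- by move=> i; apply/measurable_EFinP; exact: measurable_indic.
Qed.

(** The coordinates need not be regrouped into pairs: the measure of a section at [x] is a product
    whose factors each depend on one coordinate of [x], so [integral_prod_tuple] applies again. *)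
Lemma measure_coordinatewise n A :
  (forall i, measurable (A i)) ->
  (lebesgue_tuple n \x lebesgue_tuple n) (coordinatewise A) =
  \prod_(i < n) (lam \x lam) (A i).
Proof.
move=> mA; rewrite [LHS]/product_measure1.
under eq_integral do rewrite /= xsection_coordinatewise//.
rewrite (integral_prod_tuple (f := fun i => lam \o xsection (A i)))//.
by move=> i; exact: measurable_fun_xsection.
Qed.

End tuple_integrals.

(** * Second moments *)

Section second_moment.
Context (d0 : measure_display) (Omega : measurableType d0) (R : realType)
  (P : probability Omega R).

Let fineP A : d0.-measurable A -> P A = (fine (P A))%:E.
Proof. by move=> mA; rewrite fineK// fin_num_measure. Qed.

Let integral_sum_indic (I : finType) (E : I -> set Omega) :
  (forall i, measurable (E i)) ->
  (\int[P]_w (\sum_i \1_(E i) w)%:E = (\sum_i fine (P (E i)))%:E)%E.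
Proof.
move=> mE; under eq_integral do rewrite -sumEFin.
rewrite ge0_integral_sum//.
- by rewrite -sumEFin; apply: eq_bigr => i _; rewrite integral_indic// setIT; exact: fineP.
- by move=> i; apply/measurable_EFinP; exact: measurable_indic.
Qed.

(** Chebyshev's inequality, the variance being the sum of all covariances. *)
Lemma chebyshev_sum_indic (I : finType) (E : I -> set Omega) (a : R) :
  (forall i, measurable (E i)) -> 0 < a ->
  (P [set w | a <= `|\sum_i \1_(E i) w - \sum_i fine (P (E i))|]%R <=
  ((\sum_i \sum_j (fine (P (E i `&` E j)) - fine (P (E i)) * fine (P (E j)))) /
    a ^+ 2)%R%:E)%E.
Proof.
move=> mE a0; set c := \sum_i fine (P (E i)).
pose X w : R := \sum_i \1_(E i) w.
have X0 w : 0 <= X w by apply: sumr_ge0.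
have c0 : 0 <= c by apply: sumr_ge0 => i _; exact: fine_ge0.
have mX : measurable_fun [set: Omega] X.
  by apply: measurable_sum => i; exact: measurable_indic.
set A := [set w | _].
have mA : measurable A.
  rewrite -[X in measurable X]setTI.
  have -> : A = (fun w => a <= `|X w - c|) @^-1` [set true] by apply/seteqP; split.
  apply: measurable_fun_ler => //; apply: measurableT_comp => //.
  exact: measurable_funB.
have mIJ (p : I * I) : measurable (E p.1 `&` E p.2) by exact: measurableI.
have X2 w : X w ^+ 2 = \sum_(p : I * I) \1_(E p.1 `&` E p.2) w.
  rewrite expr2 big_distrlr /= pair_bigA; apply: eq_bigr => p _.
  by rewrite indicI.
have IX : (\int[P]_w (X w)%:E = c%:E)%E by exact: integral_sum_indic.
have IX2 : (\int[P]_w (X w ^+ 2)%:E = (\sum_i \sum_j fine (P (E i `&` E j)))%:E)%E.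
  under eq_integral do rewrite X2.
  by rewrite integral_sum_indic// pair_bigA.
have m1A : measurable_fun [set: Omega] (fun w => (\1_A w)%:E : \bar R).
  by apply/measurable_EFinP; exact: measurable_indic.
have mXE : measurable_fun [set: Omega] (fun w => (X w)%:E) by exact/measurable_EFinP.
(* The inequality [a^2 1_A <= (X - c)^2] with the cross term moved to the left: all integrands are
   nonnegative, so no integrability is to be checked. *)
have key : (\int[P]_w ((a ^+ 2)%:E * (\1_A w)%:E + (2 * c)%:E * (X w)%:E) <=
            \int[P]_w ((X w ^+ 2)%:E + (c ^+ 2)%:E))%E.
  apply: ge0_le_integral => //.
  - by move=> w _; rewrite adde_ge0// mule_ge0// lee_fin ?sqr_ge0// mulr_ge0.
  - by apply: emeasurable_funD; exact: measurable_funeM.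
  - apply: emeasurable_funD => //; apply/measurable_EFinP.
    exact: measurable_funX.
  - move=> w _; rewrite -!EFinM -!EFinD lee_fin indicE.
    have [|] := boolP (w \in A); last first.
      by rewrite mulr0 => _; have := sqr_ge0 (X w - c); rewrite sqrrB; lra.
    rewrite mulr1 inE /A /= -/(X w) => aX.
    have : a ^+ 2 <= (X w - c) ^+ 2.
      by rewrite -[leRHS]real_normK ?num_real// ler_sqr ?nnegrE// ltW.
    by rewrite sqrrB; lra.
have a2 : 0 < a ^+ 2 by rewrite exprn_gt0.
have f1 w : setT w -> (0 <= (a ^+ 2)%:E * (\1_A w)%:E :> \bar R)%E.
  by move=> _; rewrite mule_ge0// lee_fin ltW.
have f2 w : setT w -> (0 <= (2 * c)%:E * (X w)%:E)%E.
  by move=> _; rewrite mule_ge0// lee_fin ?mulr_ge0.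
have f3 w : setT w -> (0 <= (X w ^+ 2)%:E)%E by move=> _; rewrite lee_fin sqr_ge0.
have f4 (w : Omega) : setT w -> (0 <= (c ^+ 2)%:E)%E by move=> _; rewrite lee_fin sqr_ge0.
have Ic : (\int[P]_w (c ^+ 2)%:E = (c ^+ 2)%:E)%E.
  rewrite integral_cst// -[RHS]mule1; congr (_ * _)%E; exact: probability_setT.
have I1 : (\int[P]_w (\1_A w)%:E = (fine (P A))%:E)%E.
  by rewrite integral_indic// setIT; exact: fineP.
have m3 : measurable_fun [set: Omega] (fun w => (X w ^+ 2)%:E).
  by apply/measurable_EFinP; exact: measurable_funX.
move: key; rewrite (ge0_integralD _ measurableT f1 (measurable_funeM _ m1A)
  f2 (measurable_funeM _ mXE)) (ge0_integralD _ measurableT f3 m3 f4 (measurable_cst _)).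
rewrite !ge0_integralZl ?lee_fin ?sqr_ge0 ?mulr_ge0//; last first.
  by move=> w _; rewrite lee_fin.
rewrite IX IX2 I1 Ic -!EFinM -!EFinD !lee_fin => key; rewrite (fineP mA) lee_fin.
rewrite ler_pdivlMr//.
have -> : \sum_i \sum_j (fine (P (E i `&` E j)) - fine (P (E i)) * fine (P (E j))) =
    \sum_i \sum_j fine (P (E i `&` E j)) - c ^+ 2.
  rewrite expr2 big_distrlr -sumrB; apply: eq_bigr => i _.
  by rewrite -sumrB.
lra.
Qed.

End second_moment.

Section covariance_bound.
Context (d0 : measure_display) (Omega : measurableType d0) (R : realType)
  (P : probability Omega R).
Variables (E : nat -> nat -> set Omega) (b : R).
Hypothesis mE : forall k l, measurable (E k l).
Hypothesis EC : forall k l, E k l = E l k.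
Hypothesis b_ge0 : 0 <= b.
Hypothesis P1 : forall k l, (1 <= k)%N -> (1 <= l)%N -> k != l ->
  (P (E k l) <= b%:E)%E.
Hypothesis P2 : forall k l l', (1 <= k)%N -> (1 <= l)%N -> (1 <= l')%N ->
  k != l -> k != l' -> l != l' -> (P (E k l `&` E k l') <= (b ^+ 2)%:E)%E.
Hypothesis P3 : forall k l k' l', (1 <= k)%N -> (1 <= l)%N -> (1 <= k')%N ->
  (1 <= l')%N -> uniq [:: k; l; k'; l'] ->
  P (E k l `&` E k' l') = (P (E k l) * P (E k' l'))%E.

(** Diagonal pairs and those involving index 0 get the empty event, so that sums run over all
    pairs. *)
Definition pair_event N (p : 'I_N * 'I_N) : set Omega :=
  if [&& (1 <= p.1)%N, (1 <= p.2)%N & p.1 != p.2] then E p.1 p.2 else set0.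

Lemma measurable_pair_event N p : measurable (@pair_event N p).
Proof. by rewrite /pair_event; case: ifP => // _; exact: measurable0. Qed.

Let pr A := fine (P A).

Let pr_ge0 A : 0 <= pr A. Proof. exact: fine_ge0. Qed.

Let pr_le A c : measurable A -> (P A <= c%:E)%E -> pr A <= c.
Proof. by move=> mA h; rewrite -lee_fin fineK// fin_num_measure. Qed.

(** The covariance of disjoint pairs vanishes. Otherwise the subtracted product is dropped: one
    common index costs [b^2], and equal unordered pairs cost [b]. *)
Let cov_le N (p q : 'I_N * 'I_N) :
  pr (pair_event p `&` pair_event q) - pr (pair_event p) * pr (pair_event q) <=
  b ^+ 2 * ((p.1 == q.1)%:R + (p.1 == q.2)%:R + (p.2 == q.1)%:R + (p.2 == q.2)%:R) +
  b * ((p == q)%:R + (p == (q.2, q.1))%:R).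
Proof.
have pp0 : 0 <= pr (pair_event p) * pr (pair_event q) by rewrite mulr_ge0.
have b2 : 0 <= b ^+ 2 by rewrite sqr_ge0.
have n0 (c : bool) : 0 <= c%:R :> R by case: c.
have rhs0 : 0 <= b ^+ 2 * ((p.1 == q.1)%:R + (p.1 == q.2)%:R + (p.2 == q.1)%:R + (p.2 == q.2)%:R) +
  b * ((p == q)%:R + (p == (q.2, q.1))%:R).
  by rewrite addr_ge0// mulr_ge0// ?addr_ge0.
have pr0 : pr set0 = 0 by rewrite /pr measure0.
have [|np] := boolP [&& (1 <= p.1)%N, (1 <= p.2)%N & p.1 != p.2]; last first.
  have -> : pair_event p = set0 by rewrite /pair_event (negbTE np).
  by rewrite set0I pr0 mul0r subrr.
have [|nq] := boolP [&& (1 <= q.1)%N, (1 <= q.2)%N & q.1 != q.2]; last first.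
  have -> : pair_event q = set0 by rewrite /pair_event (negbTE nq).
  by rewrite setI0 pr0 mulr0 subrr.
move=> vq vp.
have Ep : pair_event p = E p.1 p.2 by rewrite /pair_event vp.
have Eq : pair_event q = E q.1 q.2 by rewrite /pair_event vq.
move: vp vq; rewrite Ep Eq in pp0 *.
have mI k l k' l' : measurable (E k l `&` E k' l') by exact: measurableI.
case: p q {Ep Eq rhs0} pp0 => [k l] [k' l'] /= pp0 /and3P[k1 l1 kl] /and3P[k1' l1' kl'].
have P1' (m n : 'I_N) A : (1 <= m)%N -> (1 <= n)%N -> m != n -> pr (E m n `&` E m n) <= b.
  by move=> *; rewrite setIid; apply: pr_le => //; apply: P1.
have P2' (j m n : 'I_N) : (1 <= j)%N -> (1 <= m)%N -> (1 <= n)%N ->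
    j != m -> j != n -> m != n -> pr (E j m `&` E j n) <= b ^+ 2.
  by move=> *; apply: pr_le => //; apply: P2.
have viaX X Y c : 1 <= X -> 0 <= Y -> c <= b ^+ 2 -> c - pr (E k l) * pr (E k' l') <= b ^+ 2 * X + b * Y.
  move=> X1 Y0 cb; have : b ^+ 2 * 1 <= b ^+ 2 * X by rewrite ler_wpM2l.
  have : 0 <= b * Y by rewrite mulr_ge0.
  lra.
have viaY X Y c : 0 <= X -> 1 <= Y -> c <= b -> c - pr (E k l) * pr (E k' l') <= b ^+ 2 * X + b * Y.
  move=> X1 Y0 cb; have : b * 1 <= b * Y by rewrite ler_wpM2l.
  have : 0 <= b ^+ 2 * X by rewrite mulr_ge0.
  lra.
have X1 (c1 c2 c3 c4 : bool) : [|| c1, c2, c3 | c4] ->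
    1 <= c1%:R + c2%:R + c3%:R + c4%:R :> R.
  by rewrite -!natrD ler1n; case: c1; case: c2; case: c3; case: c4.
have Y1 (c1 c2 : bool) : c1 || c2 -> 1 <= c1%:R + c2%:R :> R.
  by rewrite -!natrD ler1n; case: c1; case: c2.
have X0 (c1 c2 c3 c4 : bool) : 0 <= c1%:R + c2%:R + c3%:R + c4%:R :> R.
  by rewrite !addr_ge0.
have Y0 (c1 c2 : bool) : 0 <= c1%:R + c2%:R :> R by rewrite addr_ge0.
rewrite !xpair_eqE.
have [e1|n1] := eqVneq k k'; [subst k'|].
  have [e2|n2] := eqVneq l l'; [subst l'|].
    by apply: viaY; [exact: X0|exact: Y1|exact: P1'].
  by apply: viaX; [exact: X1|exact: Y0|exact: P2'].
have [e1|n1'] := eqVneq k l'; [subst l'|].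
  have [e2|n2] := eqVneq l k'; [subst k'|].
    apply: viaY; [exact: X0|exact: Y1|].
    by rewrite [E l k]EC; apply: P1'.
  apply: viaX; [exact: X1|exact: Y0|].
  by rewrite (EC k' k); apply: P2' => //; rewrite eq_sym.
have [e1|n2] := eqVneq l k'; [subst k'|].
  apply: viaX; [exact: X1|exact: Y0|].
  by rewrite (EC k l); apply: P2' => //; rewrite eq_sym.
have [e1|n2'] := eqVneq l l'; [subst l'|].
  apply: viaX; [exact: X1|exact: Y0|].
  by rewrite (EC k l) (EC k' l); apply: P2' => //; rewrite eq_sym.
have -> : pr (E k l `&` E k' l') = pr (E k l) * pr (E k' l').
  rewrite /pr P3// ?fineM ?fin_num_measure//.
  rewrite /= !inE !negb_or -!andbA.
  by do ![apply/andP; split].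
by rewrite subrr addr_ge0// mulr_ge0// !addr_ge0.
Qed.

Lemma sum_cov_le N :
  \sum_(p : 'I_N * 'I_N) \sum_(q : 'I_N * 'I_N)
    (pr (pair_event p `&` pair_event q) - pr (pair_event p) * pr (pair_event q)) <=
  4 * b ^+ 2 * N%:R ^+ 3 + 2 * b * N%:R ^+ 2.
Proof.
have delta (T : finType) (x : T) : \sum_(y : T) (x == y)%:R = 1 :> R.
  rewrite (bigD1 x)//= eqxx big1 ?addr0// => y /negbTE.
  by rewrite eq_sym => ->.
have sum1 : \sum_(i < N) (1 : R) = N%:R by rewrite sumr_const card_ord.
apply: le_trans (ler_sum _ (fun p _ => ler_sum _ (fun q _ => cov_le p q))) _.
have sum_fst (F : 'I_N -> R) : \sum_(q : 'I_N * 'I_N) F q.1 = N%:R * \sum_i F i.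
  rewrite -(pair_bigA _ (fun i j => F i))/= mulr_sumr; apply: eq_bigr => i _.
  by rewrite sumr_const card_ord mulr_natl.
have sum_snd (F : 'I_N -> R) : \sum_(q : 'I_N * 'I_N) F q.2 = N%:R * \sum_i F i.
  by rewrite -(pair_bigA _ (fun i j => F j))/= sumr_const card_ord mulr_natl.
have card2 : \sum_(p : 'I_N * 'I_N) (1 : R) = N%:R ^+ 2.
  by rewrite sumr_const card_prod card_ord natrM expr2.
rewrite (eq_bigr (fun=> b ^+ 2 * (4 * N%:R) + b * 2)) => [|p _].
  rewrite -[X in \sum_p X]mulr1 -mulr_sumr card2.
  by rewrite le_eqVlt; apply/orP; left; apply/eqP; ring.
rewrite big_split/= -!mulr_sumr !big_split/=.
rewrite !(sum_fst (fun i => (_ == i)%:R)) !(sum_snd (fun i => (_ == i)%:R)) !delta.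
have -> : \sum_(q : 'I_N * 'I_N) (p == (q.2, q.1))%:R = 1 :> R.
  rewrite -[RHS](delta _ (p.2, p.1)); apply: eq_bigr => -[i j] _.
  by case: p => m n /=; rewrite !xpair_eqE andbC.
by ring.
Qed.

End covariance_bound.

(** * Joint laws of independent uniform vectors *)

Section restriction_to_cube.
Context {R : realType} (n : nat).
Local Open Scope ereal_scope.

Lemma measurable_unit_cube : measurable (@unit_cube R n).
Proof.
have -> : @unit_cube R n = \bigcap_(i : 'I_n)
    ([set x | (0 <= tnth x i)%R] `&` [set x | (tnth x i <= 1)%R]).
  apply/seteqP; split => [x xc i _|x xc i]; first by have /andP[] := xc i.
  by apply/andP; have [] := xc i I.
apply: fin_bigcap_measurable => // i _; apply: measurableI;
  by apply: measurable_set_le => //; exact: (@measurable_tnth _ R).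
Qed.

Variable Q : probability (n.-tuple R) R.
Hypothesis QE : forall A, measurable A -> Q A = lebesgue_tuple n (A `&` @unit_cube R n).

Lemma uniform_le_lebesgue A : measurable A -> Q A <= lebesgue_tuple n A.
Proof.
move=> mA; rewrite QE//; apply: le_measure; rewrite ?inE//.
by apply: measurableI => //; exact: measurable_unit_cube.
Qed.

(** [Q \x Q] and Lebesgue measure restricted to the square of the cube agree on rectangles, hence
    everywhere. *)
Lemma uniform_product_lebesgue (S : set (n.-tuple R * n.-tuple R)) : measurable S ->
  S `<=` @unit_cube R n `*` @unit_cube R n ->
  (Q \x Q) S = (lebesgue_tuple n \x lebesgue_tuple n) S.
Proof.
move=> mS Sc; have mC := measurable_unit_cube.
have mCC : measurable (@unit_cube R n `*` @unit_cube R n) by exact: measurableX.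
pose m' : {measure set (n.-tuple R * n.-tuple R) -> \bar R} :=
  [the measure _ _ of mrestr (lebesgue_tuple n \x lebesgue_tuple n) mCC].
have m'E A : m' A = (lebesgue_tuple n \x lebesgue_tuple n)
  (A `&` (@unit_cube R n `*` @unit_cube R n)) by [].
rewrite (@product_measure_unique _ _ _ _ _ Q Q m')//; first by rewrite m'E setIidl.
move=> A B mA mB; rewrite m'E -setXI.
have -> := product_measure1E (lebesgue_tuple n) (lebesgue_tuple n)
  (measurableI _ _ mA mC) (measurableI _ _ mB mC).
by congr (_ * _); apply/esym; exact: QE.
Qed.

End restriction_to_cube.

Section joint_laws.
Context (disp disp' : measure_display) (Omega : measurableType disp)
  (T : measurableType disp') (R : realType) (P : probability Omega R)
  (X : nat -> {RV P >-> T}) (Q : probability T R).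
Hypothesis X_indep : mutually_independent [set n | (1 <= n)%N] X.
Hypothesis X_law : forall n A, (1 <= n)%N -> measurable A -> P (X n @^-1` A) = Q A.
Local Open Scope ereal_scope.

Lemma indep_seq (s : seq nat) (A : nat -> set T) :
  uniq s -> all (leq 1) s -> (forall i, measurable (A i)) ->
  P (\bigcap_(i in [set` s]) X i @^-1` A i) = \prod_(i <- s) Q (A i).
Proof.
move=> us /allP s1 mA.
have := X_indep (J := [fset i in s]%fset) (A := A).
have -> : [set` [fset i in s]%fset] = [set` s].
  by apply/seteqP; split => i /=; rewrite inE.
move=> -> //.
rewrite (perm_big s)/=; last first.
  by apply: uniq_perm => [|//|i]; [exact: fset_uniq|rewrite inE].
by apply: eq_big_seq => i /s1 i1; rewrite X_law.
Qed.

Let mX n : measurable_fun [set: Omega] (X n).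
Proof. exact: measurable_funPT. Qed.

Let mpre n A : measurable A -> measurable (X n @^-1` A).
Proof. by move=> mA; rewrite -[X in measurable X]setTI; exact: mX. Qed.

Lemma indep2 k l A B : (1 <= k)%N -> (1 <= l)%N -> k != l ->
  measurable A -> measurable B ->
  P (X k @^-1` A `&` X l @^-1` B) = Q A * Q B.
Proof.
move=> k1 l1 kl mA mB.
have := @indep_seq [:: k; l] (fun i => if i == k then A else B).
rewrite /= inE kl k1 l1 => /(_ isT isT); rewrite !big_cons big_nil mule1 eqxx.
rewrite eq_sym in kl; rewrite (negbTE kl) => <-; last by move=> i; case: ifP.
congr (P _); apply/seteqP; split => w.
  by move=> [wA wB] i /=; rewrite !inE => /orP[] /eqP ->; rewrite ?eqxx// (negbTE kl).
move=> H; split.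
  by have := H k; rewrite /= inE eqxx; apply.
by have := H l; rewrite /= !inE eqxx orbT (negbTE kl); apply.
Qed.

Lemma indep3 k l m A B C : (1 <= k)%N -> (1 <= l)%N -> (1 <= m)%N ->
  uniq [:: k; l; m] -> measurable A -> measurable B -> measurable C ->
  P (X k @^-1` A `&` (X l @^-1` B `&` X m @^-1` C)) = Q A * (Q B * Q C).
Proof.
move=> k1 l1 m1 u mA mB mC.
have := @indep_seq [:: k; l; m] (fun i => if i == k then A else if i == l then B else C).
rewrite u /= k1 l1 m1 => /(_ isT isT); rewrite !big_cons big_nil mule1 !eqxx.
move: u; rewrite /= !inE negb_or andbT => /andP[/andP[kl km] lm].
rewrite [l == k]eq_sym [m == k]eq_sym [m == l]eq_sym (negbTE kl) (negbTE km) (negbTE lm).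
move=> <-; last by move=> i; do 2 case: ifP => //.
congr (P _); apply/seteqP; split => w.
  move=> [wA [wB wC]] i /=; rewrite !inE => /or3P[] /eqP ->; rewrite ?eqxx//.
    by rewrite eq_sym (negbTE kl).
  by rewrite [m == k]eq_sym [m == l]eq_sym (negbTE km) (negbTE lm).
move=> H; split; [|split].
- by have := H k; rewrite /= inE eqxx; apply.
- by have := H l; rewrite /= !inE eqxx orbT [l == k]eq_sym (negbTE kl); apply.
- have := H m; rewrite /= !inE eqxx !orbT [m == k]eq_sym [m == l]eq_sym.
  by rewrite (negbTE km) (negbTE lm); apply.
Qed.

Lemma indep4 k l m n A B C D : (1 <= k)%N -> (1 <= l)%N -> (1 <= m)%N -> (1 <= n)%N ->
  uniq [:: k; l; m; n] ->
  measurable A -> measurable B -> measurable C -> measurable D ->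
  P ((X k @^-1` A `&` X l @^-1` B) `&` (X m @^-1` C `&` X n @^-1` D)) =
  (Q A * Q B) * (Q C * Q D).
Proof.
move=> k1 l1 m1 n1 u mA mB mC mD.
have := @indep_seq [:: k; l; m; n] (fun i => if i == k then A else
  if i == l then B else if i == m then C else D).
rewrite u /= k1 l1 m1 n1 => /(_ isT isT); rewrite !big_cons big_nil mule1 !eqxx.
move: u; rewrite /= !inE !negb_or andbT -!andbA => /and5P[kl km kn lm /andP[ln mn]].
rewrite [l == k]eq_sym [m == k]eq_sym [n == k]eq_sym [m == l]eq_sym [n == l]eq_sym.
rewrite [n == m]eq_sym (negbTE kl) (negbTE km) (negbTE kn) (negbTE lm) (negbTE ln).
rewrite (negbTE mn) !muleA => <-; last by move=> i; do 3 case: ifP => //.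
congr (P _); apply/seteqP; split => w.
  move=> [[wA wB] [wC wD]] i /=; rewrite !inE => /or4P[] /eqP ->; rewrite ?eqxx//.
  - by rewrite eq_sym (negbTE kl).
  - by rewrite [m == k]eq_sym [m == l]eq_sym (negbTE km) (negbTE lm).
  - rewrite [n == k]eq_sym [n == l]eq_sym [n == m]eq_sym (negbTE kn).
    by rewrite (negbTE ln) (negbTE mn).
move=> H; split; split.
- by have := H k; rewrite /= inE eqxx; apply.
- by have := H l; rewrite /= !inE eqxx orbT [l == k]eq_sym (negbTE kl); apply.
- have := H m; rewrite /= !inE eqxx !orbT [m == k]eq_sym [m == l]eq_sym.
  by rewrite (negbTE km) (negbTE lm); apply.
- have := H n; rewrite /= !inE eqxx !orbT [n == k]eq_sym [n == l]eq_sym.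
  by rewrite [n == m]eq_sym (negbTE kn) (negbTE ln) (negbTE mn); apply.
Qed.

Lemma law_pair k l S : (1 <= k)%N -> (1 <= l)%N -> k != l -> measurable S ->
  P [set w | S (X k w, X l w)] = (Q \x Q) S.
Proof.
move=> k1 l1 kl mS.
have := @product_law_on _ _ _ _ _ _ _ P setT (X k) (X l) Q Q.
rewrite probability_setT => /(_ measurableT (mX k) (mX l) _ S mS).
rewrite setTI mul1e; apply => A B mA mB.
by rewrite setTI mul1e indep2.
Qed.

(** [product_law_on] is used twice: given the event of [S], it reduces [S'] to rectangles; given
    such a rectangle, it reduces [S] to rectangles, where [indep4] concludes. *)
Lemma law_pair_pair k l m n S S' : (1 <= k)%N -> (1 <= l)%N -> (1 <= m)%N -> (1 <= n)%N ->
  uniq [:: k; l; m; n] -> measurable S -> measurable S' ->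
  P ([set w | S (X k w, X l w)] `&` [set w | S' (X m w, X n w)]) =
  P [set w | S (X k w, X l w)] * P [set w | S' (X m w, X n w)].
Proof.
move=> k1 l1 m1 n1 u mS mS'.
have /and4P[kl lmn mn _] : [&& k \notin [:: l; m; n], l \notin [:: m; n], m \notin [:: n] & true] := u.
have {}kl : k != l by apply: contra kl => /eqP ->; rewrite inE eqxx.
have {}mn : m != n by rewrite inE in mn.
have mpair i j U : measurable U -> measurable [set w | U (X i w, X j w)].
  move=> mU; rewrite -[X in measurable X]setTI.
  by apply: (measurable_fun_pair (mX i) (mX j)).
have mnE := law_pair m1 n1 mn mS'.
rewrite mnE; apply: product_law_on => //; first exact: mpair.
move=> A B mA mB; rewrite setIC.
have := @product_law_on _ _ _ _ _ _ _ P (X m @^-1` A `&` X n @^-1` B) (X k) (X l) Q Q.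
move=> ->//.
- by rewrite indep2// muleC law_pair.
- by apply: measurableI; exact: mpre.
- move=> C D mC mD; rewrite setIC indep4//  indep2// muleC//.
Qed.

(** Given the common value [X k = x], the two conditions bear on independent vectors: the section at
    [x] is the product of two sections of measure at most [b]. *)
Lemma law_shared k l m S S' (b : R) : (1 <= k)%N -> (1 <= l)%N -> (1 <= m)%N ->
  uniq [:: k; l; m] -> measurable S -> measurable S' -> (0 <= b)%R ->
  (forall x, Q (xsection S x) <= b%:E) -> (forall x, Q (xsection S' x) <= b%:E) ->
  P ([set w | S (X k w, X l w)] `&` [set w | S' (X k w, X m w)]) <= (b ^+ 2)%:E.
Proof.
move=> k1 l1 m1 u mS mS' b0 Sb S'b.
pose W := [set p : T * (T * T) | S (p.1, p.2.1) /\ S' (p.1, p.2.2)].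
have mW : measurable W.
  have m21 : measurable_fun [set: T * (T * T)] (fun p => (p.1, p.2.1)).
    by apply: measurable_fun_pair => //; exact: (measurableT_comp measurable_fst).
  have m22 : measurable_fun [set: T * (T * T)] (fun p => (p.1, p.2.2)).
    by apply: measurable_fun_pair => //; exact: (measurableT_comp measurable_snd).
  apply: measurableI; rewrite -[X in measurable X]setTI; first exact: m21.
  exact: m22.
have -> : P ([set w | S (X k w, X l w)] `&` [set w | S' (X k w, X m w)]) = (Q \x (Q \x Q)) W.
  have := @product_law_on _ _ _ _ _ _ _ P setT (X k) (fun w => (X l w, X m w)) Q (Q \x Q).
  rewrite probability_setT => /(_ measurableT (mX k) _ _ W mW).
  rewrite setTI mul1e; apply; first exact: measurable_fun_pair.
  move=> A B mA mB; rewrite setTI mul1e -(X_law k1 mA).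
  apply: product_law_on => //; first exact: mpre.
  by move=> C D mC mD; rewrite X_law// indep3.
pose QQ : probability (T * T)%type R := Q \x Q.
have -> : (Q \x (Q \x Q)) W = \int[Q]_x QQ (xsection W x) by [].
apply: (@le_trans _ _ (\int[Q]_x (b ^+ 2)%:E)).
  apply: ge0_le_integral => //.
    exact: (measurable_fun_xsection QQ mW).
  move=> x _; rewrite /QQ /=.
  have -> : xsection W x = xsection S x `*` xsection S' x.
    apply/seteqP; split => -[y z].
      by move=> /xsectionP[? ?]; split; apply/xsectionP.
    by move=> [/xsectionP ? /xsectionP ?]; apply/xsectionP.
  have mSx := measurable_xsection x mS; have mS'x := measurable_xsection x mS'.
  have -> := product_measure1E Q Q mSx mS'x.
  by rewrite expr2 EFinM; apply: lee_pmul; rewrite ?measure_ge0//; [exact: Sb|exact: S'b].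
by rewrite integral_cst// -[leRHS]mule1 lee_wpmul2l ?lee_fin ?sqr_ge0// probability_le1.
Qed.

Lemma law_pair_le k l S (b : R) : (1 <= k)%N -> (1 <= l)%N -> k != l ->
  measurable S -> (0 <= b)%R -> (forall x, Q (xsection S x) <= b%:E) ->
  P [set w | S (X k w, X l w)] <= b%:E.
Proof.
move=> k1 l1 kl mS b0 Sb; rewrite law_pair//.
have -> : (Q \x Q) S = \int[Q]_x Q (xsection S x) by [].
apply: (@le_trans _ _ (\int[Q]_x b%:E)).
  by apply: ge0_le_integral => //; exact: (measurable_fun_xsection Q mS).
by rewrite integral_cst// -[leRHS]mule1 lee_wpmul2l// probability_le1.
Qed.

End joint_laws.

(** * Expectation of the pair correlation *)

Section scaling.
Context {R : realType} (d : nat).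
Hypothesis d_gt0 : (0 < d)%N.
Implicit Types (s : R) (N : nat).

Definition scale_radius s N : R := s / (N%:R `^ (d%:R^-1)).

Lemma scale_radius_gt0 s N : 0 < s -> (0 < N)%N -> 0 < scale_radius s N.
Proof. by move=> s0 N0; rewrite divr_gt0// powR_gt0// ltr0n. Qed.

Lemma scale_radiusX s N : scale_radius s N ^+ d = s ^+ d / N%:R.
Proof.
rewrite expr_div_n; congr (_ / _).
rewrite -powR_mulrn ?powR_ge0// -powRrM mulVf ?powRr1//.
by rewrite pnatr_eq0 -lt0n.
Qed.

Lemma cvg_scale_radius s : 0 < s -> scale_radius s N @[N --> \oo] --> (0 : R).
Proof.
move=> s0; apply/cvgrPdist_le => /= eta eta0.
near=> N; have N0 : (0 < N)%N by near: N; exists 1%N.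
rewrite sub0r normrN ger0_norm ?(ltW (scale_radius_gt0 s0 N0))//.
rewrite -(@ler_pXn2r _ d)// ?nnegrE ?(ltW (scale_radius_gt0 s0 N0)) ?(ltW eta0)//.
rewrite scale_radiusX ler_pdivrMr ?ltr0n// -ler_pdivrMl ?exprn_gt0//.
near: N; exact: nbhs_infty_ger.
Unshelve. all: by end_near. Qed.

End scaling.

(** Shifting both indices by one preserves differences; the subtracted term is the diagonal. *)
Lemma sum_pairs_diff (R : realType) N (F : R -> R) :
  \sum_(p : 'I_N.+1 * 'I_N.+1)
    (if [&& (1 <= p.1)%N, (1 <= p.2)%N & p.1 != p.2] then F (p.1%:R - p.2%:R) else 0) =
  \sum_(k < N) \sum_(l < N) F (k%:R - l%:R) - N%:R * F 0.
Proof.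
rewrite -(pair_bigA _ (fun k l : 'I_N.+1 =>
  if [&& (1 <= k)%N, (1 <= l)%N & k != l] then F (k%:R - l%:R) else 0))/=.
rewrite big_ord_recl [X in X + _]big1 ?add0r//.
have -> : N%:R * F 0 = \sum_(k < N) F 0 by rewrite sumr_const card_ord mulr_natl.
rewrite -sumrB; apply: eq_bigr => k _.
rewrite big_ord_recl add0r (bigD1 k)//= eqxx add0r [in RHS](bigD1 k)//= subrr.
rewrite addrAC subrr add0r; apply: eq_bigr => l lk.
rewrite /bump !add1n /= (inj_eq lift_inj) eq_sym lk -!natr1.
by congr F; ring.
Qed.

Section expectation.
Context {R : realType} (d : nat) (alpha : 'I_d -> R) (e s : R).
Hypothesis d_gt0 : (0 < d)%N.
Hypothesis alpha_indep : forall (m : 'I_d -> int) (p : int),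
  \sum_i (m i)%:~R * alpha i = p%:~R -> forall i, m i = 0.
Hypotheses (e_gt0 : 0 < e) (s_gt0 : 0 < s).
Local Notation lam := (@lebesgue_measure R).

Definition close_prob (z delta : R) : R :=
  \prod_i fine ((lam \x lam)%E (close_pairs (z * alpha i) e delta)).

(** As [(2 r)^d = (2 s)^d / N], the sum is [(2 s)^d] times the average of [h] over all differences,
    minus a diagonal term [O (1 / N)]. The factors of [h] approach [dens] uniformly, so the average
    tends to 1. *)
Lemma cvg_sum_close_prob :
  N%:R^-1 * \sum_(p : 'I_N.+1 * 'I_N.+1)
    (if [&& (1 <= p.1)%N, (1 <= p.2)%N & p.1 != p.2]
     then close_prob (p.1%:R - p.2%:R) (scale_radius d s N) else 0)
  @[N --> \oo] --> (2 * s) ^+ d.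
Proof.
have e0 := e_gt0; have s0 := s_gt0.
pose E := 2 * (e + 1).
(* The constant of [close_pairs_measure] after division by [2 * delta]. *)
pose C := 4 / e ^+ 2 * (E * (1 + E ^- 2)).
have E0 : 0 < E by rewrite mulr_gt0// addr_gt0.
have e2 : 0 <= e ^- 2 by rewrite invr_ge0 sqr_ge0.
have E2 : 0 <= E ^- 2 by rewrite invr_ge0 sqr_ge0.
have C0 : 0 <= C.
  by apply: mulr_ge0; [exact: mulr_ge0|apply: mulr_ge0; [exact: ltW|exact: addr_ge0]].
pose B := 1 + e ^- 2 + C.
have B1 : 1 <= B by rewrite /B; lra.
pose q N z i := fine ((lam \x lam)%E (close_pairs (z * alpha i) e (scale_radius d s N))) /
  (2 * scale_radius d s N).
pose h N z := \prod_(i < d) q N z i.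
pose r := scale_radius d s.
have r_lt : \forall N \near \oo, 0 < r N < 2^-1.
  have /cvgrPdist_lt /(_ 2^-1) := cvg_scale_radius d_gt0 s0.
  rewrite invr_gt0 ltr0n => /(_ isT) H; near=> N.
  have N0 : (0 < N)%N by near: N; exists 1%N.
  rewrite scale_radius_gt0//=.
  suff : `|0 - r N| < 2^-1 by rewrite sub0r normrN ltr_norml => /andP[].
  by near: N.
have qE N z i : 0 < r N < 2^-1 -> `|q N z i - dens e (alpha i * z)| <= C * r N.
  move=> rN; have /andP[r0 _] := rN; have [_] := close_pairs_measure e0 (z * alpha i) rN.
  rewrite /q -/(r N) -/E [z * _]mulrC; set w := fine _ => H.
  have r2 : 0 < 2 * r N by rewrite mulr_gt0.
  have -> : w / (2 * r N) - dens e (alpha i * z) =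
      (w - 2 * r N * dens e (alpha i * z)) / (2 * r N).
    by field; rewrite gt_eqF.
  rewrite normrM [X in _ * X]gtr0_norm ?invr_gt0// ler_pdivrMr//.
  apply: le_trans H _; rewrite le_eqVlt /C; apply/orP; left; apply/eqP; ring.
have densB z i : `|dens e (alpha i * z)| <= B.
  by apply: le_trans (dens_norm_le _ e0) _; rewrite /B; lra.
have qB N z i : 0 < r N < 2^-1 -> `|q N z i| <= B.
  move=> rN; have h2 := qE _ z i rN; have h1 := dens_norm_le (alpha i * z) e0.
  have h3 : C * r N <= C * 1 by rewrite ler_wpM2l//; lra.
  rewrite -(subrK (dens e (alpha i * z)) (q N z i)) /B.
  apply: le_trans (ler_normD _ _) _; lra.
have avg_h : diff_avg (h N) N @[N --> \oo] --> (1 : R).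
  pose u N := diff_avg (fun z => \prod_i dens e (alpha i * z)) N.
  have cu : u N @[N --> \oo] --> (1 : R) by exact: diff_avg_prod_dens.
  have cv : diff_avg (h N) N - u N @[N --> \oo] --> (0 : R).
    apply/norm_cvg0P.
    apply: (@squeeze_cvgr _ _ _ _ (fun=> 0) (fun N => (d%:R * B ^+ d * C) * r N)).
    - near=> N; rewrite normr_ge0/=.
      have rN : 0 < r N < 2^-1 by near: N.
      have /andP[r0 _] := rN.
      rewrite -mulrA; apply: diff_avg_dist => [|z].
        by rewrite !mulr_ge0// ?exprn_ge0 ?(ltW r0)//; lra.
      rewrite -[d in d%:R]card_ord -[d in B ^+ d]card_ord.
      apply: prod_dist => // [|i|i]; [|exact: qB|exact: qE].
      by rewrite mulr_ge0// ltW.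
    - exact: cvg_cst.
    - rewrite -(mulr0 (d%:R * B ^+ d * C)); apply: cvgM; first exact: cvg_cst.
      exact: cvg_scale_radius.
  have lim : diff_avg (h N) N - u N + u N @[N --> \oo] --> (1 : R).
    by rewrite -[X in _ --> X](add0r 1); exact: cvgD.
  by apply: eq_cvg_gt0 lim => N _; rewrite subrK.
have diag : N%:R^-1 * h N 0 @[N --> \oo] --> (0 : R).
  apply/norm_cvg0P.
  apply: (@squeeze_cvgr _ _ _ _ (fun=> 0) (fun N => B ^+ d * harmonic N.-1)).
  - near=> N; have N0 : (0 < N)%N by near: N; exists 1%N.
    have rN : 0 < r N < 2^-1 by near: N.
    rewrite normr_ge0/= normrM ger0_norm ?invr_ge0// mulrC /harmonic/= prednK//.
    rewrite ler_wpM2r ?invr_ge0// /h normr_prod -[in leRHS](card_ord d) -prodr_const.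
    by apply: ler_prod => i _; rewrite normr_ge0 qB.
  - exact: cvg_cst.
  - have h0 : harmonic N.-1 @[N --> \oo] --> (0 : R).
      by rewrite -cvg_shiftS; exact: cvg_harmonic.
    by rewrite -(mulr0 (B ^+ d)); exact: cvgM (cvg_cst _) h0.
have lim : (2 * s) ^+ d * (diff_avg (h N) N - N%:R^-1 * h N 0) @[N --> \oo] -->
    (2 * s) ^+ d.
  rewrite -[X in _ --> X]mulr1; apply: cvgM; first exact: cvg_cst.
  by rewrite -[X in _ --> X]subr0; exact: cvgB.
apply: eq_cvg_gt0 lim => N N0 /=.
have r0 : 0 < r N by exact: scale_radius_gt0.
have hE z : close_prob z (r N) = (2 * s) ^+ d / N%:R * h N z.
  rewrite /h /q big_split/= -/(close_prob z (r N)) prodr_const card_ord.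
  rewrite exprVn [(2 * scale_radius d s N) ^+ d]exprMn scale_radiusX// exprMn; field.
  by rewrite !expf_neq0 ?pnatr_eq0 -?lt0n ?N0 ?gt_eqF.
rewrite (sum_pairs_diff _ (fun z => close_prob z (r N))) hE.
under eq_bigr do under eq_bigr do rewrite hE.
under eq_bigr do rewrite -mulr_sumr.
rewrite -mulr_sumr /diff_avg; field.
by rewrite pnatr_eq0 -lt0n.
Unshelve. all: by end_near. Qed.

End expectation.

(** * Almost sure convergence *)

Section borel_cantelli.
Context (d0 : measure_display) (Omega : measurableType d0) (R : realType)
  (P : probability Omega R).

(** Comparison with a telescoping sum: [1 / (x + 1)^2 <= 1 / x - 1 / (x + 1)]. *)
Lemma sum_invr_sqr_le n : \sum_(0 <= k < n.+1) (k.+1%:R ^+ 2)^-1 <= 2 - n.+1%:R^-1 :> R.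
Proof.
elim: n => [|n IH]; first by rewrite big_nat1 expr1n invr1; lra.
rewrite big_nat_recr//=; apply: le_trans (lerD IH (lexx _)) _.
have n0 : 0 < n.+1%:R :> R by rewrite ltr0n.
rewrite -[n.+2%:R]natr1; move: n.+1%:R n0 => x x0.
rewrite -subr_ge0.
have -> : 2 - (x + 1)^-1 - (2 - x^-1 + ((x + 1) ^+ 2)^-1) = (x * (x + 1) ^+ 2)^-1.
  by field; rewrite !gt_eqF// addr_gt0.
by rewrite invr_ge0 mulr_ge0 ?(ltW x0)// exprn_ge0// addr_ge0// ltW.
Qed.

(** The Borel-Cantelli lemma is applied to the thresholds [1 / (j + 1)], so that only countably many
    null sets are discarded. *)
Lemma ae_cvg0 (Z : nat -> Omega -> R) :
  (forall m, measurable_fun [set: Omega] (Z m)) ->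
  (forall eta : R, 0 < eta -> exists2 C : R, 0 <= C &
    \forall m \near \oo,
      (P [set w | (eta <= `|Z m w|)%R] <= (C / m.+1%:R ^+ 2)%R%:E)%E) ->
  {ae P, forall w, Z m w @[m --> \oo] --> (0 : R)}.
Proof.
move=> mZ PZ.
have mA (eta : R) m : measurable [set w | eta <= `|Z m w|].
  apply: measurable_set_le => //; exact: measurableT_comp.
have : {ae P, forall w, forall j : nat, \forall m \near \oo, `|Z m w| < j.+1%:R^-1}.
  apply: ae_foralln => j.
  have [|C C0 [m0 _ H]] := PZ j.+1%:R^-1; first by rewrite invr_gt0.
  (* Shifting by [m0] makes the tail bound hold for every [k]. *)
  pose F k := [set w | j.+1%:R^-1 <= `|Z (k + m0)%N w|].
  exists (lim_sup_set F); split.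
  - by apply: bigcap_measurable => // n _; apply: bigcup_measurable => k _; exact: mA.
  - apply: lim_sup_set_cvg0 => [k|]; first exact: mA.
    apply: (@le_lt_trans _ _ (C * 2)%:E); last exact: ltry.
    apply: lime_le; first by apply: is_cvg_nneseries => *; exact: measure_ge0.
    apply: nearW => -[|n]; first by rewrite big_nil lee_fin mulr_ge0.
    apply: (@le_trans _ _ (\sum_(0 <= k < n.+1) (C * (k.+1%:R ^+ 2)^-1)%R%:E)%E).
      apply: lee_sum => k _; apply: le_trans (H _ _) _; first by rewrite /= leq_addl.
      rewrite lee_fin ler_wpM2l// lef_pV2 ?posrE ?exprn_gt0 ?ltr0n//.
      by rewrite ler_sqr ?nnegrE// ler_nat ltnS leq_addr.
    rewrite sumEFin lee_fin -mulr_sumr ler_wpM2l//.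
    apply: le_trans (sum_invr_sqr_le n) _.
    by rewrite lerBlDr lerDl invr_ge0.
  - move=> w /= nw n _; apply: contrapT => nF; apply: nw.
    exists (n + m0)%N => // m /= nm; rewrite ltNge; apply/negP => Zm.
    apply: nF; exists (m - m0)%N => /=; first by lia.
    by rewrite /F /= subnK// (leq_trans _ nm)// leq_addl.
apply: filterS => w Hw; apply/cvgrPdist_lt => /= eta eta0.
have [j jeta] : exists j : nat, j.+1%:R^-1 <= eta.
  exists (Num.truncn eta^-1); rewrite -[leRHS]invrK lef_pV2 ?posrE ?invr_gt0 ?ltr0n//.
  exact/ltW/truncnS_gt.
apply: filterS (Hw j) => m Zm.
by rewrite sub0r normrN; exact: lt_le_trans jeta.
Unshelve. all: by end_near. Qed.

End borel_cantelli.

Section distance_to_integers.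
Context {R : realType}.
Implicit Types (x y delta : R).

(** The infimum is attained at the floor of [y] or at the next integer. *)
Lemma dist_int_le y delta :
  dist_int y <= delta <-> exists m : int, `|y - m%:~R| <= delta.
Proof.
have lb0 : has_lbound [set `|y - m%:~R| | m in [set: int]].
  by exists 0 => _ [m _ <-].
split => [|[m ym]]; last by apply: le_trans ym; apply: ge_inf => //; exists m.
pose f := Num.floor y.
have /andP[fy yf] := floor_itv y; rewrite -/f intrD in yf.
have lb (m : int) : `|y - f%:~R| <= `|y - m%:~R| \/ `|y - (f + 1)%:~R| <= `|y - m%:~R|.
  have [mf|fm] := leP m f.
    left; rewrite ger0_norm ?subr_ge0//; apply: le_trans (ler_norm _).
    by rewrite lerD2l lerN2 ler_int.
  right; rewrite distrC ger0_norm; last by rewrite subr_ge0 intrD ltW.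
  rewrite [leRHS]distrC; apply: le_trans (ler_norm _); rewrite lerD2r ler_int; lia.
move=> yd; apply: contrapT => H.
have h (m : int) : delta < `|y - m%:~R|.
  by rewrite ltNge; apply/negP => ?; apply: H; exists m.
have : Num.min `|y - f%:~R| `|y - (f + 1)%:~R| <= dist_int y.
  apply: lb_le_inf; first by exists `|y - 0%:~R|; exists 0.
  by move=> _ [m _ <-]; rewrite ge_min; apply/orP; exact: lb.
by apply/negP; rewrite -ltNge (le_lt_trans yd)// lt_min !h.
Qed.

(** Taking fractional parts changes each difference by an integer, which is absorbed in [m]. The
    sign of [delta] accounts for the default value 0 of the maximum. *)
Lemma dist_int_max_le d (a b : d.-tuple R) delta : 0 <= delta ->
  dist_int_max (vsub (vfrac a) (vfrac b)) <= delta <->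
  forall i, exists m : int, `|tnth a i - tnth b i - m%:~R| <= delta.
Proof.
move=> d0; rewrite /dist_int_max.
have -> : \big[Num.max/0]_(i < d) dist_int (tnth (vsub (vfrac a) (vfrac b)) i) <= delta <->
    forall i, dist_int (tnth (vsub (vfrac a) (vfrac b)) i) <= delta.
  split => [H i|H]; last exact: bigmax_le.
  by apply: le_trans H; exact: le_bigmax.
have shift i : tnth (vsub (vfrac a) (vfrac b)) i =
    tnth a i - tnth b i - (Num.floor (tnth a i) - Num.floor (tnth b i))%:~R.
  by rewrite !tnth_mktuple /Defs.frac intrB; ring.
split => H i.
  have /dist_int_le[m] := H i; rewrite shift => mE.
  exists (Num.floor (tnth a i) - Num.floor (tnth b i) + m).
  by rewrite intrD opprD addrA.
apply/dist_int_le; have [m mE] := H i.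
exists (m - (Num.floor (tnth a i) - Num.floor (tnth b i))).
rewrite shift [X in _ - X]intrB.
by rewrite (_ : _ - _ - _ = tnth a i - tnth b i - m%:~R)//; ring.
Qed.

End distance_to_integers.

Lemma exists_sqr_itv N : exists m, (m ^ 2 <= N < m.+1 ^ 2)%N.
Proof.
elim: N => [|N [m /andP[mN Nm]]]; first by exists 0%N.
have [h|h] := ltnP N.+1 (m.+1 ^ 2); first by exists m; rewrite (leq_trans mN)//=.
by exists m.+1; rewrite h /= (leq_ltn_trans Nm)//; lia.
Qed.

Lemma exists_frac_itv (R : realType) (u v : R) : 0 < u -> u < v ->
  exists a b : nat, u < a.+1%:R / b.+1%:R < v.
Proof.
move=> u0 uv; have [q] := rat_in_itvoo uv; rewrite in_itv/= => /andP[uq qv].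
have q0 : (0 < q)%R by rewrite -(ltr0q R) (lt_trans u0).
have n0 : 0 < numq q by rewrite numq_gt0.
have d0 := denq_gt0 q.
exists (absz (numq q)).-1, (absz (denq q)).-1.
rewrite !prednK ?absz_gt0 ?gt_eqF// !natr_absz !gtr0_norm//.
by move: uq qv; rewrite /ratr => -> ->.
Qed.

(** * From squares to all [N] *)

Section squares.
Context {R : realType} (d : nat) (x : nat -> d.-tuple R).
Hypothesis d_gt0 : (0 < d)%N.

Lemma pair_correlation_mono N M s t : (0 < N)%N -> (0 < M)%N -> (N <= M)%N ->
  0 <= s -> 0 <= t -> s ^+ d * M%:R <= t ^+ d * N%:R ->
  N%:R * pair_correlation x N s <= M%:R * pair_correlation x M t.
Proof.
move=> N0 M0 NM s0 t0 st.
have N0' : 0 < N%:R :> R by rewrite ltr0n.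
have M0' : 0 < M%:R :> R by rewrite ltr0n.
rewrite /pair_correlation !mulVKf ?gt_eqF// ler_nat.
have rst : s / (N%:R `^ (d%:R^-1)) <= t / (M%:R `^ (d%:R^-1)).
  rewrite -(@ler_pXn2r _ d)// ?nnegrE ?divr_ge0 ?powR_ge0//.
  by rewrite !(scale_radiusX d_gt0) ler_pdivrMr// mulrAC ler_pdivlMr.
pose f (p : 'I_N.+1 * 'I_N.+1) : 'I_M.+1 * 'I_M.+1 :=
  (widen_ord (leq_ltn_trans NM (ltnSn M)) p.1, widen_ord (leq_ltn_trans NM (ltnSn M)) p.2).
have f_inj : injective f.
  move=> [i j] [k l] /= [ik jl]; congr pair; exact/val_inj.
rewrite -(fintype.card_image f_inj); apply: subset_leq_card; apply/fintype.subsetP => q /mapP[p].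
rewrite mem_enum !inE => /and4P[p1 p2 pp pd] ->{q} /=.
by rewrite p1 p2 /= (le_trans pd) ?andbT.
Qed.

(** For [m^2 <= N < (m + 1)^2] and rationals [s1 < s < s2] the count at [N] lies between those at
    the two squares. As [(m + 1)^2 / m^2] tends to 1, the gaps between [s1], [s] and [s2] eventually
    absorb the change of scale. *)
Lemma poissonian_of_squares :
  (forall a b : nat,
    pair_correlation x (m ^ 2)%N (a.+1%:R / b.+1%:R) @[m --> \oo] -->
      ((2 * (a.+1%:R / b.+1%:R)) ^+ d : R)) ->
  poissonian_pair_correlations x.
Proof.
move=> H s s0; apply/cvgrPdist_le => /= eta eta0.
have cont : (2 * t) ^+ d @[t --> s] --> ((2 * s) ^+ d : R).
  exact: (continuous_comp (@mulrl_continuous R 2 s) (@exprn_continuous R d (2 * s))).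
have /cvgrPdist_le /(_ (eta / 4)) := cont.
rewrite divr_gt0// => /(_ isT) /nbhs_ballP[rho /= rho0 near_s].
have rho_s (t : R) : `|s - t| < rho -> `|(2 * s) ^+ d - (2 * t) ^+ d| <= eta / 4.
  by move=> st; apply: near_s.
pose sigma := Num.min rho s.
have sigma0 : 0 < sigma by rewrite lt_min rho0.
have sigma_rho : sigma <= rho by rewrite ge_min lexx.
have sigma_s : sigma <= s by rewrite ge_min lexx orbT.
(* [sigma <= s] keeps [s1] positive; [sigma <= rho] keeps both rationals where [(2 t)^d] is within
   [eta / 4] of its value at [s]. *)
have [a1 [b1]] := @exists_frac_itv R (s - sigma / 2) s ltac:(lra) ltac:(lra).
have [a2 [b2]] := @exists_frac_itv R s (s + sigma / 2) ltac:(lra) ltac:(lra).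
have := H a1 b1; have := H a2 b2.
move: (_ / b1.+1%:R) (_ / b2.+1%:R) => s1 s2 H2 H1 /andP[ss2 s2s] /andP[ss1 s1s].
have s10 : 0 < s1 by lra.
have e1 : `|(2 * s) ^+ d - (2 * s1) ^+ d| <= eta / 4 by apply: rho_s; rewrite ltr_norml; lra.
have e2 : `|(2 * s) ^+ d - (2 * s2) ^+ d| <= eta / 4 by apply: rho_s; rewrite ltr_norml; lra.
pose ratio m := (m.+1 ^ 2)%:R / (m ^ 2)%:R : R.
have cvg_ratio : ratio m @[m --> \oo] --> (1 : R).
  have h0 : harmonic m.-1 @[m --> \oo] --> (0 : R).
    by rewrite -cvg_shiftS; exact: cvg_harmonic.
  have lim : (1 + harmonic m.-1) * (1 + harmonic m.-1) @[m --> \oo] -->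
      ((1 + 0) * (1 + 0) : R).
    by apply: cvgM; apply: cvgD => //; exact: cvg_cst.
  rewrite addr0 mulr1 in lim.
  apply: eq_cvg_gt0 lim => m m0.
  rewrite /ratio /harmonic/= prednK// !natrX -natr1.
  by field; rewrite pnatr_eq0 -lt0n.
have cvg_inv_ratio : (ratio m)^-1 @[m --> \oo] --> (1 : R).
  by rewrite -[X in _ --> X]invr1; apply: cvgV => //; rewrite oner_neq0.
have up : ratio m * pair_correlation x (m.+1 ^ 2)%N s2 @[m --> \oo] --> (2 * s2) ^+ d.
  rewrite -[X in _ --> X]mul1r; apply: cvgM => //.
  by rewrite (cvg_shiftS (fun m => pair_correlation x (m ^ 2)%N s2)).
have low : (ratio m)^-1 * pair_correlation x (m ^ 2)%N s1 @[m --> \oo] --> (2 * s1) ^+ d.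
  by rewrite -[X in _ --> X]mul1r; exact: cvgM.
have ratio_lt t u : 0 < t -> t < u -> \forall m \near \oo, t ^+ d * ratio m <= u ^+ d.
  move=> t0 tu.
  have lim : t ^+ d * ratio m @[m --> \oo] --> (t ^+ d : R).
    by rewrite -[X in _ --> X]mulr1; apply: cvgM => //; exact: cvg_cst.
  have tud : t ^+ d < u ^+ d by rewrite ltr_pXn2r// nnegrE ltW// (lt_trans t0).
  move/cvgrPdist_le : lim => /(_ (u ^+ d - t ^+ d)); rewrite subr_gt0 => /(_ tud).
  by apply: filterS => m; rewrite ler_norml; lra.
have [m0 _ Hm] : \forall m \near \oo, [/\ (0 < m)%N,
   s ^+ d * ratio m <= s2 ^+ d, s1 ^+ d * ratio m <= s ^+ d,
   `|(2 * s2) ^+ d - ratio m * pair_correlation x (m.+1 ^ 2)%N s2| <= eta / 4 &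
   `|(2 * s1) ^+ d - (ratio m)^-1 * pair_correlation x (m ^ 2)%N s1| <= eta / 4].
  near=> m; split; near: m.
  - by exists 1%N.
  - exact: ratio_lt.
  - exact: ratio_lt.
  - by move/cvgrPdist_le : up; apply; rewrite divr_gt0.
  - by move/cvgrPdist_le : low; apply; rewrite divr_gt0.
exists (m0 ^ 2)%N => // N /= m0N.
have [m /andP[mN Nm]] := exists_sqr_itv N.
have m0m : (m0 <= m)%N.
  by rewrite -ltnS -(@ltn_exp2r _ _ 2)// (leq_ltn_trans m0N).
have [m_gt0 r2 r1 U L] := Hm m m0m.
have m20 : 0 < (m ^ 2)%:R :> R by rewrite ltr0n expn_gt0 m_gt0.
have M20 : 0 < (m.+1 ^ 2)%:R :> R by rewrite ltr0n expn_gt0.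
have N_gt0 : (0 < N)%N by rewrite (leq_trans _ mN)// expn_gt0 m_gt0.
have N0 : 0 < N%:R :> R by rewrite ltr0n.
have mNR : (m ^ 2)%:R <= N%:R :> R by rewrite ler_nat.
have NMR : N%:R <= (m.+1 ^ 2)%:R :> R by rewrite ler_nat ltnW.
have F0 n t : 0 <= pair_correlation x n t by rewrite mulr_ge0// invr_ge0.
have upN : pair_correlation x N s <= ratio m * pair_correlation x (m.+1 ^ 2)%N s2.
  have h : N%:R * pair_correlation x N s <=
      (m.+1 ^ 2)%:R * pair_correlation x (m.+1 ^ 2)%N s2.
    apply: pair_correlation_mono => //; [exact: ltnW|exact: ltW|lra|].
    apply: (@le_trans _ _ (s2 ^+ d * (m ^ 2)%:R)).
      by rewrite -ler_pdivrMr// -mulrA.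
    by rewrite ler_wpM2l// exprn_ge0//; lra.
  rewrite -ler_pdivlMl// in h; apply: le_trans h _.
  rewrite mulrA ler_wpM2r// mulrC /ratio ler_wpM2l ?(ltW M20)//.
  by rewrite lef_pV2.
have lowN : (ratio m)^-1 * pair_correlation x (m ^ 2)%N s1 <= pair_correlation x N s.
  have h : (m ^ 2)%:R * pair_correlation x (m ^ 2)%N s1 <= N%:R * pair_correlation x N s.
    apply: pair_correlation_mono => //; [by rewrite expn_gt0 m_gt0|exact: ltW|exact: ltW|].
    apply: (@le_trans _ _ (s1 ^+ d * (m.+1 ^ 2)%:R)).
      by rewrite ler_wpM2l// exprn_ge0// ltW.
    by rewrite -ler_pdivrMr// -mulrA.
  rewrite -ler_pdivrMl// in h; apply: le_trans h.
  rewrite [leRHS]mulrA ler_wpM2r// /ratio invf_div mulrC ler_wpM2r ?(ltW m20)//.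
  by rewrite lef_pV2.
move: U L e1 e2 upN lowN; rewrite !ler_norml; lra.
Unshelve. all: by end_near. Qed.

End squares.

Lemma cvg_sqr_index (R : realType) (u : nat -> R) (l : R) :
  u N @[N --> \oo] --> l -> u (m ^ 2)%N @[m --> \oo] --> l.
Proof.
move=> ul; apply: (@cvg_comp _ _ _ (fun m => m ^ 2)%N u _ _ _ _ ul).
move=> A [N _ NA]; exists N => // m /= Nm; apply: NA => /=.
by rewrite (leq_trans Nm)// -{1}(expn1 m); case: m {Nm} => // m; rewrite leq_pexp2l.
Qed.

Lemma lee_prod_const (R : realType) n (f : 'I_n -> \bar R) (c : R) : 0 <= c ->
  (forall i, 0 <= f i)%E -> (forall i, f i <= c%:E)%E ->
  (\prod_(i < n) f i <= (c ^+ n)%:E)%E.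
Proof.
move=> c0; elim: n f => [|n IH] f f0 fc; first by rewrite big_ord0 expr0.
rewrite big_ord_recl exprS EFinM; apply: lee_pmul => //.
  by apply: prode_ge0.
exact: IH.
Qed.

Lemma rationally_independent_int (R : realType) d (alpha : d.-tuple R) :
  rationally_independent (cons_tuple 1 alpha) ->
  forall (m : 'I_d -> int) (p : int),
    \sum_i (m i)%:~R * tnth alpha i = p%:~R -> forall i, m i = 0.
Proof.
move=> indep m p mp i.
(* [- p] is the coefficient of the leading component 1. *)
pose c (j : 'I_d.+1) : rat := if unlift ord0 j is Some k then (m k)%:~R else - p%:~R.
have : c (lift ord0 i) = 0.
  apply: indep; rewrite big_ord_recl /c unlift_none tnth0 mulr1.
  rewrite rmorphN/= ratr_int -mp addrC; apply/eqP; rewrite subr_eq0; apply/eqP.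
  by apply: eq_bigr => k _; rewrite liftK ratr_int tnthS.
by rewrite /c liftK => /eqP; rewrite intr_eq0 => /eqP.
Qed.

(** * The perturbed rotation *)

Section main.
Context (R : realType) (d : nat) (alpha : 'I_d -> R) (eps : R).
Context (disp : measure_display) (Omega : measurableType disp)
  (P : probability Omega R) (X : nat -> {RV P >-> d.-tuple R}).
Hypothesis d_gt0 : (0 < d)%N.
Hypothesis eps_gt0 : 0 < eps.
Hypothesis alpha_indep : forall (m : 'I_d -> int) (p : int),
  \sum_i (m i)%:~R * alpha i = p%:~R -> forall i, m i = 0.
Hypothesis X_indep : mutually_independent [set n | (1 <= n)%N] X.
Hypothesis X_unif : forall n, (1 <= n)%N -> uniform_on_cube (X n).

Let Q : probability (d.-tuple R) R := distribution P (X 1%N).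

Let QE A : measurable A -> Q A = lebesgue_tuple d (A `&` @unit_cube R d).
Proof. by move=> mA; exact: (X_unif (ltnSn 0)). Qed.

Let X_law n A : (1 <= n)%N -> measurable A -> P (X n @^-1` A) = Q A.
Proof. by move=> n1 mA; rewrite QE//; exact: X_unif. Qed.

Definition close_box (z delta : R) : set (d.-tuple R * d.-tuple R) :=
  coordinatewise (fun i => close_pairs (z * alpha i) eps delta).

Let m_box z delta : measurable (close_box z delta).
Proof. by apply: measurable_coordinatewise => i; exact: measurable_close_pairs. Qed.

Definition close_event (delta : R) (k l : nat) : set Omega :=
  [set w | close_box (k%:R - l%:R) delta (X k w, X l w)].

Let m_event delta k l : measurable (close_event delta k l).
Proof.
have mkl : measurable_fun [set: Omega] (fun w => (X k w, X l w)).
  by apply: measurable_fun_pair; exact: measurable_funPT.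
by rewrite -[X in measurable X]setTI; exact: mkl.
Qed.

Let event_sym delta k l : close_event delta k l = close_event delta l k.
Proof.
have sub i j : close_event delta i j `<=` close_event delta j i.
  move=> w H a; have [[/= x01 y01] [m mE]] := H a; split; first by split.
  exists (- m); move: mE => /=; rewrite -normrN mulrNz; congr (`|_| <= _); ring.
by apply/seteqP; split; exact: sub.
Qed.

Let box_cube z delta : close_box z delta `<=` @unit_cube R d `*` @unit_cube R d.
Proof. by move=> [x y] H; split => i /=; have [[]] := H i. Qed.

Let E := 2 * (eps + 1).
Let C := 4 / eps * (E * (1 + E ^- 2)).

Let C_ge0 : 0 <= C.
Proof.
have e0 := eps_gt0; have E0 : 0 < E by rewrite mulr_gt0// addr_gt0.
apply: mulr_ge0; first by rewrite divr_ge0// ltW.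
by apply: mulr_ge0; [exact: ltW|rewrite addr_ge0// invr_ge0 sqr_ge0].
Qed.

Let xsection_box z delta x : 0 < delta <= 1 ->
  (Q (xsection (close_box z delta) x) <= ((C * delta) ^+ d)%:E)%E.
Proof.
move=> d01; have /andP[d0 _] := d01.
have mx : measurable (xsection (close_box z delta) x) by exact: measurable_xsection.
apply: le_trans (uniform_le_lebesgue QE mx) _.
rewrite xsection_coordinatewise; last by move=> i; exact: measurable_close_pairs.
apply: lee_prod_const => [|i|i]; first by rewrite mulr_ge0// ltW.
  exact: measure_ge0.
exact: lam_xsection_close_pairs.
Qed.

Let P_event delta k l : 0 < delta < 2^-1 -> (1 <= k)%N -> (1 <= l)%N -> k != l ->
  fine (P (close_event delta k l)) = close_prob alpha eps (k%:R - l%:R) delta.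
Proof.
move=> d01 k1 l1 kl; rewrite (law_pair X_indep X_law k1 l1 kl (m_box _ _)).
rewrite (uniform_product_lebesgue QE (m_box _ _) (@box_cube _ _)).
rewrite measure_coordinatewise; last by move=> i; exact: measurable_close_pairs.
rewrite /close_prob -[RHS]/(fine (_%:E)) -prodEFin; congr fine.
apply: eq_bigr => i _; rewrite fineK//.
by have [] := close_pairs_measure eps_gt0 ((k%:R - l%:R) * alpha i) d01.
Qed.

Let event_cov delta N : 0 < delta <= 1 ->
  \sum_(p : 'I_N * 'I_N) \sum_(q : 'I_N * 'I_N)
    (fine (P (pair_event (close_event delta) p `&` pair_event (close_event delta) q)) -
     fine (P (pair_event (close_event delta) p)) * fine (P (pair_event (close_event delta) q))) <=
  4 * ((C * delta) ^+ d) ^+ 2 * N%:R ^+ 3 + 2 * (C * delta) ^+ d * N%:R ^+ 2.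
Proof.
move=> d01; have /andP[d0 _] := d01.
have b0 : 0 <= (C * delta) ^+ d by rewrite exprn_ge0// mulr_ge0// ltW.
apply: sum_cov_le => //.
- move=> k l k1 l1 kl; apply: (law_pair_le X_indep X_law) => //.
  by move=> x; exact: xsection_box.
- move=> k l l' k1 l1 l1' kl kl' ll'; apply: (law_shared X_indep X_law) => //.
  + by rewrite /= !inE negb_or kl kl' ll'.
  + by move=> x; exact: xsection_box.
  + by move=> x; exact: xsection_box.
- move=> k l k' l' k1 l1 k1' l1' u.
  exact: (law_pair_pair X_indep X_law).
Qed.

Definition close_count s N w : R :=
  \sum_(p : 'I_N.+1 * 'I_N.+1) \1_(pair_event (close_event (scale_radius d s N)) p) w.

(** At [N = m^2] the count has variance [O (N)], so a deviation of [eta N] has probability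
    [O (1 / N) = O (m^-2)], as [ae_cvg0] requires. *)
Lemma ae_close_count s : 0 < s ->
  {ae P, forall w, (m ^ 2)%N%:R^-1 * close_count s (m ^ 2)%N w @[m --> \oo] --> (2 * s) ^+ d}.
Proof.
move=> s0.
pose r m := scale_radius d s (m ^ 2)%N.
pose mean N : R := \sum_(p : 'I_N.+1 * 'I_N.+1)
  fine (P (pair_event (close_event (scale_radius d s N)) p)).
have r_lt : \forall m \near \oo, 0 < r m < 2^-1.
  have /cvgrPdist_lt /(_ 2^-1) := cvg_sqr_index (cvg_scale_radius d_gt0 s0).
  rewrite invr_gt0 ltr0n => /(_ isT) H; near=> m.
  have m0 : (0 < m)%N by near: m; exists 1%N.
  rewrite scale_radius_gt0 ?expn_gt0 ?m0//=.
  suff : `|0 - r m| < 2^-1 by rewrite sub0r normrN ltr_norml => /andP[].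
  by near: m.
have mean_cvg : (m ^ 2)%N%:R^-1 * mean (m ^ 2)%N @[m --> \oo] --> (2 * s) ^+ d.
  have := cvg_sqr_index (cvg_sum_close_prob d_gt0 alpha_indep eps_gt0 s0).
  apply: cvg_trans; apply: near_eq_cvg; near=> m.
  have rm : 0 < r m < 2^-1 by near: m.
  congr (_ * _); apply: eq_bigr => p _; rewrite /pair_event.
  case: ifPn => [/and3P[p1 p2 pp]|_]; last by rewrite measure0.
  exact/esym/P_event.
pose Z m w : R := (m ^ 2)%N%:R^-1 * (close_count s (m ^ 2)%N w - mean (m ^ 2)%N).
have mpe delta N (p : 'I_N * 'I_N) : measurable (pair_event (close_event delta) p).
  exact: measurable_pair_event.
have : {ae P, forall w, Z m w @[m --> \oo] --> (0 : R)}.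
  apply: ae_cvg0.
    move=> m; apply: measurable_funM => //; apply: measurable_funB => //.
    by apply: measurable_sum => p; exact: measurable_indic.
  move=> eta eta0.
  pose B := (C * s) ^+ d.
  have B0 : 0 <= B by rewrite exprn_ge0// mulr_ge0// ltW.
  (* In [event_cov], used with [N + 1 <= 2 N] indices and [(C r)^d = B / N], the two terms are at
     most [32 B^2 N] and [8 B N]; the factor 4 comes from [(m + 1)^2 <= 4 m^2]. *)
  exists (4 * (32 * B ^+ 2 + 8 * B) / eta ^+ 2).
    by rewrite divr_ge0 ?sqr_ge0// mulr_ge0// addr_ge0// mulr_ge0// sqr_ge0.
  near=> m.
  have m0 : (0 < m)%N by near: m; exists 1%N.
  have rm : 0 < r m < 2^-1 by near: m.
  set N := (m ^ 2)%N.
  have N_gt0 : (0 < N)%N by rewrite expn_gt0 m0.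
  have N0 : 0 < N%:R :> R by rewrite ltr0n.
  have -> : [set w | (eta <= `|Z m w|)%R] =
     [set w | (eta * N%:R <= `|close_count s N w - mean N|)%R].
    apply/seteqP; split => w /=; rewrite /Z -/N normrM gtr0_norm ?invr_gt0//;
      by rewrite ler_pdivlMl// mulrC.
  apply: le_trans (chebyshev_sum_indic P (mpe _ _) (mulr_gt0 eta0 N0)) _.
  rewrite lee_fin.
  have rm1 : 0 < r m <= 1 by lra.
  have cov := event_cov N.+1 rm1.
  have bE : (C * r m) ^+ d = B / N%:R.
    rewrite [LHS]exprMn /r scale_radiusX// /B.
    by rewrite [(C * s) ^+ d]exprMn [LHS]mulrA.
  rewrite bE in cov.
  rewrite ler_pdivrMr ?exprn_gt0 ?mulr_gt0//; apply: le_trans cov _.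
  have NN : N.+1%:R <= 2 * N%:R :> R.
    by rewrite -natr1 mulr2n mulrDl mul1r lerD2l ler1n.
  have m1 : m.+1%:R ^+ 2 <= 4 * N%:R :> R.
    have mm : m.+1%:R <= 2 * m%:R :> R by rewrite -natr1 mulr2n mulrDl mul1r lerD2l ler1n.
    apply: (@le_trans _ _ ((2 * m%:R) ^+ 2)).
      by rewrite ler_sqr ?nnegrE// mulr_ge0.
    by rewrite exprMn natrX; lra.
  apply: (@le_trans _ _ ((32 * B ^+ 2 + 8 * B) * N%:R)).
    have -> : (32 * B ^+ 2 + 8 * B) * N%:R =
        4 * (B / N%:R) ^+ 2 * (2 * N%:R) ^+ 3 + 2 * (B / N%:R) * (2 * N%:R) ^+ 2.
      by field; rewrite gt_eqF.
    have BN : 0 <= B / N%:R by rewrite divr_ge0// ltW.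
    apply: lerD; apply: ler_wpM2l.
    - by rewrite mulr_ge0// sqr_ge0.
    - by rewrite ler_pXn2r// nnegrE// mulr_ge0// ltW.
    - by rewrite mulr_ge0.
    - by rewrite ler_pXn2r// nnegrE// mulr_ge0// ltW.
  have B2 : 0 <= 32 * B ^+ 2 + 8 * B by rewrite addr_ge0// mulr_ge0// sqr_ge0.
  have -> : 4 * (32 * B ^+ 2 + 8 * B) / eta ^+ 2 / m.+1%:R ^+ 2 * (eta * N%:R) ^+ 2 =
      (32 * B ^+ 2 + 8 * B) * N%:R * (4 * N%:R / m.+1%:R ^+ 2).
    by field; rewrite nat1r pnatr_eq0 /= gt_eqF.
  rewrite ler_peMr//; first by rewrite mulr_ge0// ltW.
  by rewrite ler_pdivlMr ?exprn_gt0 ?ltr0n// mul1r.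
apply: filterS => w Zw.
have : Z m w + (m ^ 2)%N%:R^-1 * mean (m ^ 2)%N @[m --> \oo] --> 0 + (2 * s) ^+ d.
  exact: cvgD.
rewrite add0r; apply: eq_cvg_gt0 => m _.
by rewrite /Z -mulrDr subrK.
Unshelve. all: by end_near. Qed.

Definition perturbed_rotation (w : Omega) (n : nat) : d.-tuple R :=
  vfrac [tuple n%:R * alpha i + eps * tnth (X n w) i | i < d].

(** The events contain membership in the cube, which [pair_correlation] does not test; hence the
    condition on [w], which holds almost surely. *)
Lemma pair_correlation_close_count s N w : 0 < s ->
  (forall n, (1 <= n)%N -> @unit_cube R d (X n w)) ->
  pair_correlation (perturbed_rotation w) N s = N%:R^-1 * close_count s N w.
Proof.
move=> s0 Xc; rewrite /pair_correlation /close_count; congr (_ * _).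
rewrite -sum1_card natr_sum big_mkcond /=; apply: eq_bigr => p _.
rewrite indicE /pair_event inE /=.
case: (leqP 1 p.1) => p1 /=; last by rewrite in_set0.
case: (leqP 1 p.2) => p2 /=; last by rewrite in_set0.
case: eqVneq => pp /=; first by rewrite in_set0.
have delta0 : 0 <= scale_radius d s N by rewrite divr_ge0 ?powR_ge0// ltW.
have coordE i (m : int) : tnth [tuple p.1%:R * alpha i + eps * tnth (X p.1 w) i | i < d] i -
    tnth [tuple p.2%:R * alpha i + eps * tnth (X p.2 w) i | i < d] i - m%:~R =
    (p.1%:R - p.2%:R) * alpha i + eps * (tnth (X p.1 w) i - tnth (X p.2 w) i) - m%:~R.
  by rewrite !tnth_mktuple; ring.
have -> : (dist_int_max (vsub (perturbed_rotation w p.1) (perturbed_rotation w p.2)) <=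
    s / (N%:R `^ (d%:R^-1))) = (w \in close_event (scale_radius d s N) p.1 p.2).
  apply/idP/idP => [/(dist_int_max_le _ _ delta0) H|].
    rewrite inE => i; split; first by split; [exact: Xc|exact: Xc].
    by have [m mE] := H i; exists m; rewrite -coordE.
  rewrite inE => H; apply/(dist_int_max_le _ _ delta0) => i.
  by have [_ [m mE]] := H i; exists m; rewrite coordE.
by case: (w \in _).
Qed.

Lemma ae_unit_cube :
  {ae P, forall w, forall n, (1 <= n)%N -> @unit_cube R d (X n w)}.
Proof.
apply: ae_foralln => n; have [n1|n0] := leqP 1 n; last by apply: aeW.
exists (X n @^-1` (~` @unit_cube R d)); split.
- rewrite -[X in measurable X]setTI; apply: measurable_funPT => //.
  by apply: measurableC; exact: measurable_unit_cube.
- have mC : measurable (~` @unit_cube R d).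
    by apply: measurableC; exact: measurable_unit_cube.
  by apply: etrans (X_law n1 mC) _; rewrite QE// setICl measure0.
- by move=> w /= nw Xc; apply: nw.
Qed.

Lemma ae_poissonian : {ae P, forall w, poissonian_pair_correlations (perturbed_rotation w)}.
Proof.
have : {ae P, forall w, forall a b : nat,
    (m ^ 2)%N%:R^-1 * close_count (a.+1%:R / b.+1%:R) (m ^ 2)%N w @[m --> \oo] -->
    ((2 * (a.+1%:R / b.+1%:R)) ^+ d : R)}.
  by apply: ae_foralln => a; apply: ae_foralln => b; apply: ae_close_count; rewrite divr_gt0.
apply: filterS2 ae_unit_cube => w Xc H.
apply: poissonian_of_squares => // a b.
apply: eq_cvg_gt0 (H a b) => m _.
by apply: pair_correlation_close_count => //; rewrite divr_gt0.
Qed.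

End main.

Theorem theorem1p2 (R : realType) (d : nat) (d_ge1 : (1 <= d)%N)
  (alpha : d.-tuple R)
  (alpha_indep : rationally_independent (cons_tuple 1 alpha))
  (alpha_bad : forall i : 'I_d, badly_approximable (tnth alpha i))
  (disp : measure_display) (Omega : measurableType disp)
  (P : probability Omega R)
  (X : nat -> {RV P >-> d.-tuple R})
  (X_indep : mutually_independent [set n | (1 <= n)%N] X)
  (X_unif : forall n : nat, (1 <= n)%N -> uniform_on_cube (X n))
  (eps : R) (eps_gt0 : 0 < eps) :
  {ae P, forall w : Omega,
    poissonian_pair_correlations
      (fun n : nat => vfrac
        [tuple n%:R * tnth alpha i + eps * tnth (X n w) i | i < d])}.
Proof.
exact: (ae_poissonian d_ge1 eps_gt0 (rationally_independent_int alpha_indep)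
  X_indep X_unif).
Qed.
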